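(* Let $m>1$ be an odd integer, let $T>0$, and let $X$ be a centered Gaussian process with stationary increments in the sense that $$\mathbf{E}\left[(X(t)-X(s))^2\right]=\delta^2(|t-s|)$$ for all $s,t$ in the index interval of $X$, where the univariate function $\delta^2$ (the square of a non-negative function $\delta$) is increasing and concave. Then $X$ has zero odd $m$-th variation on $[0,T]$, i.e. $$\lim_{\varepsilon\to 0}\ \frac1\varepsilon\int_0^T (X(s+\varepsilon)-X(s))^m\,ds=0\quad\text{in } L^2(\Omega),$$ if and only if $\delta(r)=o\left(r^{1/(2m)}\right)$ as $r\to0^+$.
   Context: Because the integrand involves $X(s+\varepsilon)$ for $s\in[0,T]$, the process $X$ is understood to be defined on $[0,T+\varepsilon_0]$ for some fixed $\varepsilon_0>0$ (with $0<\varepsilon\le\varepsilon_0$), and the hypotheses (the formula for the increments' variance, and $\delta^2$ increasing and concave) are understood on $[0,T+\varepsilon_0]$. The process is taken in a jointly measurable version, so that the time integrals make sense. *)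

(* Defs.v *)
From HB Require Import structures.
From mathcomp Require Import all_boot all_order all_algebra.
From mathcomp Require Import all_classical all_reals all_analysis.
Import Order.TTheory GRing.Theory Num.Theory.
Import numFieldNormedType.Exports.

Set Implicit Arguments.
Unset Strict Implicit.
Unset Printing Implicit Defensive.

Local Open Scope classical_set_scope.
Local Open Scope ring_scope.

(* [normal_prob m 0] is not a point mass in the library (its density is then
   the indicator of [0, 1]), hence the separate degenerate case. *)
Definition gaussian_law (R : realType) (m s : R) (A : set R) : \bar R :=
  if s == 0 then \d_m A else normal_prob m s A.

Definition gaussian_rv d (Omega : measurableType d) (R : realType)
    (P : probability Omega R) (Y : Omega -> R) : Prop :=
  measurable_fun [set: Omega] Y /\
  exists m s : R, 0 <= s /\
    forall A : set R, measurable A -> pushforward P Y A = gaussian_law m s A.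

(* A process with index set [D] is a total function of time of which only the
   values at times in [D] are constrained. *)
Definition gaussian_process d (Omega : measurableType d) (R : realType)
    (P : probability Omega R) (D : set R) (X : R -> Omega -> R) : Prop :=
  forall (n : nat) (t : 'I_n -> R) (a : 'I_n -> R),
    (forall i, D (t i)) ->
    gaussian_rv P (fun w => \sum_(i < n) a i * X (t i) w).

Definition centered d (Omega : measurableType d) (R : realType)
    (P : probability Omega R) (D : set R) (X : R -> Omega -> R) : Prop :=
  forall t, D t -> 'E_P[X t]%E = 0%E.

Definition increments_variance d (Omega : measurableType d) (R : realType)
    (P : probability Omega R) (D : set R) (X : R -> Omega -> R)
    (v : R -> R) : Prop :=
  forall s t, D s -> D t ->
    'E_P[fun w => ((X t w - X s w) ^+ 2)%R]%E = (v `|t - s|)%:E.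

Definition jointly_measurable d (Omega : measurableType d) (R : realType)
    (D : set R) (X : R -> Omega -> R) : Prop :=
  measurable_fun (D `*` [set: Omega]) (fun p : R * Omega => X p.1 p.2).

Definition concave_function (R : realType) (D : set R) (f : R -> R) : Prop :=
  @convex_function R R^o D (fun r => - f r).

Definition cvg_L2 d (Omega : measurableType d) (R : realType)
    (P : probability Omega R) (I : Type) (F : set_system I)
    (Y : I -> Omega -> R) (Z : Omega -> R) : Prop :=
  [/\ \forall i \near F, Y i \in Lfun P 2%:E,
      Z \in Lfun P 2%:E &
      ('N[P]_2%:E[EFin \o (Y i \- Z)%R])%E @[i --> F] --> 0%E].

(* [Rintegral] is the real part of the Lebesgue integral; it is a junk value
   only for those [w] where the path integral does not converge. *)
Definition odd_variation d (Omega : measurableType d) (R : realType)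
    (X : R -> Omega -> R) (m : nat) (T eps : R) (w : Omega) : R :=
  eps^-1 * \int[lebesgue_measure]_(s in `[0, T]) (X (s + eps) w - X s w) ^+ m.

Definition zero_odd_variation d (Omega : measurableType d) (R : realType)
    (P : probability Omega R) (X : R -> Omega -> R) (m : nat) (T : R) : Prop :=
  cvg_L2 P 0^'+ (odd_variation X m T) (fun=> 0).

(* Main.v *)
(* The second moment of the odd variation is a double integral over [0, T]^2
   of the mixed moments E[U^m V^m] of increments U, V of length e. For centred
   Gaussian U, V of variance s = delta^2(e) and covariance x this is
   an odd polynomial G in x with nonnegative coefficients, at most a constant
   times s^(m-1) |x|. As delta^2 is concave, the covariances have total mass of
   order s e on each line, so the second moment is at most a constant times
   delta^(2m)(e) / e: this is sufficiency.

   For necessity one needs a lower bound although the covariances are negative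
   off the diagonal. They telescope there, G is superadditive on nonnegative
   numbers, and the negative part is compensated by the diagonal up to a
   positive term of order delta^(2(m-3))(e) gap(e)^3 / e, where gap(e) is
   half of delta^2(3e/4) - delta^2(e/4). As gap(e) <= delta^2(e), zero
   variation gives gap(e)^m = o(e), and summing delta^2(r) - delta^2(r/3) over
   r, r/3, r/9, ... yields delta^2(r) = o(r^(1/m)). The summation needs
   delta^2(0+) = 0, which holds because a jointly measurable process cannot
   have increments bounded below in mean. *)
Require Import Defs.
From HB Require Import structures.
From mathcomp Require Import all_boot all_order all_algebra.
From mathcomp Require Import all_classical all_reals all_analysis.
From mathcomp Require Import measurable_realfun.
From mathcomp Require Import ring lra zify.
Import Order.TTheory GRing.Theory Num.Theory.
Import numFieldNormedType.Exports.

Set Implicit Arguments.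
Unset Strict Implicit.
Unset Printing Implicit Defensive.

Local Open Scope classical_set_scope.
Local Open Scope ring_scope.

(** * Gaussian moments *)

(** The lower bound has to live with [gap] being possibly much smaller than [delta ^+ 2], as happens
    when [delta ^+ 2] varies slowly near 0; at a single scale it then says little about [delta]. The
    cubic term of G is the first one that yields anything: near the diagonal the covariances at
    distances u and e - u arise from two nonnegative values by moving them apart with their sum
    kept. This leaves the linear term of G unchanged and gains a multiple of the cube of the
    displacement in the cubic term. The points e/4 and 3e/4 are mirror images in e/2, where the
    displacement vanishes; their ratio 3 is what lets the bounds at successive scales telescope,
    with the factor 3^(-1/m) < 1 between them.

    Seen from a time s, the window [0, T] reaches T - s to one side and s to the other. If 2e <= T,
    one side is at least e long and gives the full gain; the other may be cut inside the diagonal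
    zone, and for it only nonnegativity is proved.

    Gaussianity is assumed through one-dimensional laws of linear combinations, so mixed moments are
    extracted from even moments of a U + V with a variable. *)

Section affine.
Context {R : realType}.
Local Notation mu := (@lebesgue_measure R).

Lemma measurable_affine (a b : R) :
  measurable_fun [set: R] (fun x : R => a * x + b).
Proof. by apply: measurable_funD => //; exact: measurable_funM. Qed.

(** The preimage measure scaled by [|a|] gives every half-open interval its length, and this
    determines Lebesgue measure. A negative slope exchanges the open and the closed end. *)
Lemma lebesgue_measure_affine (a b : R) (A : set R) : a != 0 -> measurable A ->
  mu ((fun x : R => a * x + b) @^-1` A) = ((`|a|^-1)%:E * mu A)%E.
Proof.
move=> a0 mA.
pose phi : measurableTypeR R -> measurableTypeR R := fun x => a * x + b.
have mphi : measurable_fun [set: measurableTypeR R] phi by exact: measurable_affine.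
have ia : 0 <= `|a| by [].
pose nu : {measure set (measurableTypeR R) -> \bar R} :=
  mscale (NngNum ia) (pushforward mu phi).
have H : mu A = nu mphi A.
  apply: (@lebesgue_measure_unique R (nu mphi)) => // _ [[x y]] _ <-.
  rewrite /nu /= /phi /mscale /= /pushforward.
  have [xy|yx] := ltP x y; last first.
    rewrite !set_itv_ge ?bnd_simp -?leNgt//. by rewrite preimage_set0 !measure0 mule0.
  have [ap|an|] := ltgtP a 0; last by move=> /eqP; rewrite (negbTE a0).
    rewrite [X in mu X = _](_ : _ = `]x, y]%classic)//.
    rewrite [X in (_ * mu X)%E](_ : _ = `[((y - b) / a), ((x - b) / a)[%classic).
      rewrite !lebesgue_measure_itv/= !lte_fin xy ltr_ndivrMr// divfK// ?ltrD2r// xy.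
      rewrite -!EFinD -EFinM ltr0_norm//; congr (_%:E); field.
      by rewrite a0.
    apply/seteqP; split => z /=; rewrite !in_itv/= ler_ndivrMr// ltr_ndivlMr//.
      by rewrite lerBrDr ltrBlDr mulrC andbC.
    by rewrite lerBrDr ltrBlDr mulrC andbC.
  rewrite [X in mu X = _](_ : _ = `]x, y]%classic)//.
  rewrite [X in (_ * mu X)%E](_ : _ = `]((x - b) / a), ((y - b) / a)]%classic).
    rewrite !lebesgue_measure_itv/= !lte_fin xy ltr_pdivrMr// divfK// ?ltrD2r// xy.
    rewrite -!EFinD -EFinM gtr0_norm//; congr (_%:E); field.
    by rewrite a0.
  apply/seteqP; split => z /=; rewrite !in_itv/= ler_pdivlMr// ltr_pdivrMr//.
    by rewrite lerBrDr ltrBlDr mulrC.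
  by rewrite lerBrDr ltrBlDr mulrC.
rewrite H /nu /= /mscale /= /pushforward muleA -EFinM mulVf ?normr_eq0// mul1e//.
Qed.

Lemma ge0_integral_affine (a b : R) (f : R -> \bar R) : a != 0 ->
  measurable_fun [set: R] f -> (forall x, 0 <= f x)%E ->
  (\int[mu]_x f (a * x + b)%R = (`|a|^-1)%:E * \int[mu]_x f x)%E.
Proof.
move=> a0 mf f0.
pose phi : measurableTypeR R -> measurableTypeR R := fun x => a * x + b.
have mphi : measurable_fun [set: measurableTypeR R] phi by exact: measurable_affine.
have ia : 0 <= `|a|^-1 by rewrite invr_ge0.
have := @ge0_integral_pushforward _ _ _ _ R phi mphi mu setT f measurableT mf
   (fun y _ => f0 y).
rewrite preimage_setT => <-.
rewrite -[RHS](ge0_integral_mscale mu measurableT (NngNum ia))//.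
apply: eq_measure_integral => //= A mA _.
by rewrite /pushforward lebesgue_measure_affine.
Qed.

End affine.

Section standard_normal.
Context {R : realType}.
Local Notation mu := (@lebesgue_measure R).
Local Notation N01 := (@normal_prob R 0 1).

Lemma normal_pdf_affine (m s x : R) : s != 0 ->
  normal_pdf m s (s * x + m) = `|s|^-1 * normal_pdf 0 1 x.
Proof.
move=> s0; rewrite /normal_pdf (negbTE s0) oner_eq0.
rewrite /normal_peak /normal_fun addrK subr0 exprMn expr1n (mul1r pi).
rewrite -mulrnAr sqrtrM ?sqr_ge0// sqrtr_sqr invfM -mulrA.
congr (_ * (_ * expR _)).
by field.
Qed.

Lemma normal_prob_affine (m s : R) (A : set R) : s != 0 -> measurable A ->
  normal_prob m s A = N01 ((fun x => s * x + m) @^-1` A).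
Proof.
move=> s0 mA; rewrite /normal_prob.
rewrite integral_mkcond [RHS]integral_mkcond.
set F := (X in (\int[_]_x X x = _)%E).
have mF : measurable_fun [set: R] F.
  apply/(measurable_restrictT _ _).1 => //.
  apply: measurable_funTS; apply/measurable_EFinP.
  exact: measurable_normal_pdf.
have F0 x : (0 <= F x)%E.
  by rewrite /F patchE; case: ifP => // _; rewrite lee_fin normal_pdf_ge0.
have ss : (`|s|%:E * (`|s|^-1)%:E = 1 :> \bar R)%E.
  by rewrite -EFinM divff// normr_eq0.
have := ge0_integral_affine m s0 mF F0.
set I1 := (\int[mu]_x F x)%E => E.
rewrite -[LHS]mul1e -ss -muleA -E {E I1} -ge0_integralZl//=; last first.
  by apply: measurableT_comp mF _; exact: measurable_affine.
apply: eq_integral => x _; rewrite /F !patchE.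
have -> : (x \in (fun x => s * x + m) @^-1` A) = (s * x + m \in A).
  by apply/idP/idP => /set_mem h; exact/mem_set.
case: ifPn => // _; rewrite ?mule0//.
by rewrite normal_pdf_affine// -EFinM mulrA divff ?normr_eq0// mul1r.
Qed.

(** For [s = 0] the affine map is constant, so the standard normal law covers the degenerate case as
    well. *)
Lemma gaussian_law_affine (m s : R) (A : set R) : measurable A ->
  gaussian_law m s A = N01 ((fun x => s * x + m) @^-1` A).
Proof.
move=> mA; rewrite /gaussian_law; case: eqP => [->|/eqP s0]; last first.
  exact: normal_prob_affine.
rewrite diracE; have [mem|nmem] := boolP (m \in A).
  rewrite [X in N01 X](_ : _ = setT) ?probability_setT//.
  by apply/seteqP; split => x //= _; rewrite mul0r add0r; exact/set_mem.
rewrite [X in N01 X](_ : _ = set0) ?measure0//.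
by apply/seteqP; split => x //=; rewrite mul0r add0r => /mem_set; rewrite (negbTE nmem).
Qed.

(** The Radon-Nikodym derivative and the density have the same integral over every measurable set,
    hence agree almost everywhere. *)
Lemma ge0_integral_normal_prob (f : R -> \bar R) :
  measurable_fun [set: R] f -> (forall x, 0 <= f x)%E ->
  (\int[N01]_x f x = \int[mu]_x (f x * (normal_pdf 0 1 x)%:E))%E.
Proof.
move=> mf f0.
rewrite -(Radon_Nikodym_SigmaFinite.change_of_variables (normal_prob_dominates 0 1))//.
have pm : measurable_fun [set: R] (fun x => (normal_pdf 0 1 x)%:E : \bar R).
  by apply/measurable_EFinP; exact: measurable_normal_pdf.
have iRN := Radon_Nikodym_SigmaFinite.f_integrable (normal_prob_dominates (0:R) 1).
apply: ae_eq_integral => //.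
- by apply: emeasurable_funM => //; apply: (measurable_int mu).
- by apply: emeasurable_funM.
- apply: ae_eqe_mul2l => /=.
  apply: integral_ae_eq => //=.
  by move=> E _ mE; rewrite -Radon_Nikodym_SigmaFinite.f_integral//; exact: normal_prob_dominates.
Qed.

(** The n-th power of [y <= expR y] at y = x^2 / (4n). It dominates all moments by one function that
    is integrable for the normal law. *)
Lemma exprn_even_le_expR (n : nat) (x : R) :
  x ^+ (2 * n) <= (4 * n%:R) ^+ n * expR (x ^+ 2 / 4).
Proof.
have [->|n0] := posnP n.
  by rewrite muln0 !expr0 mul1r -[leLHS]expR0 ler_expR divr_ge0// sqr_ge0.
have n0' : n%:R != 0 :> R by rewrite pnatr_eq0 -lt0n.
have -> : x ^+ 2 / 4 = n%:R * (x ^+ 2 / (4 * n%:R)) by field.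
rewrite mulr_natl expRM_natl -exprMn exprM ler_pXn2r//; last 2 first.
- by rewrite nnegrE sqr_ge0.
- by rewrite nnegrE mulr_ge0 ?expR_ge0// mulr_ge0.
rewrite mulrC -ler_pdivrMr; last by rewrite pmulrn_lgt0 ?ltr0n.
by apply: le_trans (expR_ge1Dx _); rewrite lerDr.
Qed.

(** Multiplying exp(- x^2 / 2) by exp(x^2 / 4) gives, up to a constant, the normal density of
    variance 2. *)
Lemma integrable_expR_quarter :
  N01.-integrable [set: R] (fun x => (expR (x ^+ 2 / 4))%:E).
Proof.
have mE : measurable_fun [set: R] (fun x : R => expR (x ^+ 2 / 4)).
  by apply: measurableT_comp => //; exact: measurable_funM.
apply/integrableP; split; first by apply/measurable_EFinP.
rewrite ge0_integral_normal_prob//=; last first.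
  by do 2 apply/measurableT_comp => //.
have s2 : Num.sqrt 2 != 0 :> R by rewrite gt_eqF// sqrtr_gt0.
have p2 : normal_peak (Num.sqrt 2 : R) != 0 by rewrite gt_eqF// normal_peak_gt0.
rewrite (eq_integral (fun x : measurableTypeR R => ((normal_peak 1 / normal_peak (Num.sqrt 2))%:E *
    (normal_pdf 0 (Num.sqrt 2) x)%:E)%E)); last first.
  move=> x _; rewrite -!EFinM /normal_pdf (negbTE s2) oner_eq0; congr (_%:E).
  rewrite ger0_norm ?expR_ge0// [RHS]mulrA divfK// mulrCA; congr (_ * _).
  rewrite /normal_fun sqr_sqrtr// -expRD expr1n subr0.
  by congr expR; field.
rewrite integralZl//; last exact: integrable_normal_pdf.
by rewrite integral_normal_pdf mule1 ltry.
Qed.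

Lemma integrable_normal_moment (n : nat) :
  N01.-integrable [set: R] (fun x => (x ^+ n)%:E).
Proof.
have mX k : measurable_fun [set: R] (fun x : R => x ^+ k) by exact: measurable_funX.
have := integrableZl measurableT (1 + (4 * n%:R) ^+ n) integrable_expR_quarter.
apply: le_integrable => //.
- by apply/measurable_EFinP.
- move=> x _; rewrite -EFinM !abse_EFin lee_fin normrX.
  rewrite [leRHS]ger0_norm; last first.
    by rewrite mulr_ge0 ?expR_ge0// addr_ge0// exprn_ge0// mulr_ge0.
  rewrite mulrDl mul1r.
  have h : `|x| ^+ n <= 1 + x ^+ (2 * n).
    have [x1|x1] := leP `|x| 1.
      by rewrite (@le_trans _ _ 1) ?exprn_ile1// lerDl mulnC exprM sqr_ge0.
    rewrite mulnC exprM -real_normK ?num_real// normrX.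
    by rewrite (@le_trans _ _ ((`|x| ^+ n) ^+ 2)) ?lerDr// expr2 ler_peMr// exprn_ege1// ltW.
  apply: (le_trans h); apply: lerD; last exact: exprn_even_le_expR.
  by rewrite -[leLHS]expR0 ler_expR divr_ge0// sqr_ge0.
Qed.

Definition normal_moment (n : nat) : R := \int[N01]_x (x ^+ n).

(** Symmetry: the density depends on the deviation only through its square, so deviations 1 and -1
    give the same law. *)
Lemma normal_moment1 : normal_moment 1 = 0.
Proof.
suff : normal_moment 1 = - normal_moment 1 by move=> h; lra.
pose phi : measurableTypeR R -> measurableTypeR R := fun x => -1 * x + 0.
have mphi : measurable_fun [set: measurableTypeR R] phi by exact: measurable_affine.
have sym (A : set R) : measurable A -> N01 A = pushforward N01 phi A.
  move=> mA; have n1 : -1 != 0 :> R by rewrite oppr_eq0 oner_eq0.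
  transitivity (normal_prob 0 (-1) A); last exact: (normal_prob_affine 0 n1 mA).
  rewrite /normal_prob; apply: eq_integral => x _.
  rewrite /normal_pdf oppr_eq0 oner_eq0 /normal_peak /normal_fun.
  by rewrite sqrrN.
have mx : measurable_fun [set: measurableTypeR R] (fun x => (x ^+ 1)%:E : \bar R).
  by apply/measurable_EFinP; exact: measurable_funX.
have iphi : N01.-integrable (phi @^-1` setT) ((fun x => (x ^+ 1)%:E) \o phi).
  rewrite preimage_setT.
  apply: eq_integrable (integrableZl measurableT (-1) (integrable_normal_moment 1)) => //.
  by move=> x _; rewrite /= /phi addr0 -EFinM !expr1.
have := @integral_pushforward _ _ _ _ R phi mphi N01 setT _ mx iphi measurableT.
have <- : (\int[N01]_y (y ^+ 1)%:E = \int[pushforward N01 phi]_y (y ^+ 1)%:E)%E.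
  by apply: eq_measure_integral => A mA _; exact: (sym A mA).
rewrite /normal_moment /Rintegral => h; rewrite [in LHS]h.
rewrite preimage_setT [in LHS](eq_integral (fun x : measurableTypeR R => (-1)%:E * (x ^+ 1)%:E)%E); last first.
  by move=> x _; rewrite /= /phi addr0 -EFinM !expr1.
rewrite integralZl//; last exact: integrable_normal_moment.
have fn : (\int[N01]_x (x ^+ 1)%:E)%E \is a fin_num.
  by apply: integrable_fin_num => //; exact: integrable_normal_moment.
by rewrite -(fineK fn) -EFinM /= mulN1r.
Qed.

(** A vanishing integral would concentrate the law on the zero set of x^(2n), which lies in {0} and
    is null by absolute continuity. *)
Lemma normal_moment_even_gt0 (n : nat) : 0 < normal_moment (2 * n).
Proof.
have x0 (x : R) : 0 <= x ^+ (2 * n) by rewrite mulnC exprM sqr_ge0.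
have fn : (\int[N01]_x (x ^+ (2 * n))%:E)%E \is a fin_num.
  by apply: integrable_fin_num => //; exact: integrable_normal_moment.
rewrite lt_neqAle Rintegral_ge0// andbT eq_sym.
apply/negP => /eqP /(congr1 (@EFin R)); rewrite /normal_moment /Rintegral fineK//.
move=> h.
have mX : measurable_fun [set: R] (fun x => (x ^+ (2 * n))%:E : \bar R).
  by apply/measurable_EFinP; exact: measurable_funX.
have : (\int[N01]_x `|(x ^+ (2 * n))%:E| = 0)%E.
  by rewrite -[RHS]h; apply: eq_integral => x _; rewrite gee0_abs// lee_fin.
move=> /(ae_eq_integral_abs N01 measurableT mX) [B [mB B0 sub]].
have mu0 : mu [set 0 : R] = 0 by exact: lebesgue_measure_set1.
have N0 : N01 [set 0] = 0.
  by have /null_content_dominatesP := normal_prob_dominates (0:R) 1; apply.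
have : (N01 [set: R] <= N01 (B `|` [set 0%R]))%E.
  apply: le_measure; rewrite ?inE//; first exact: measurableU.
  move=> x _; have [->|x0'] := eqVneq x 0; first by right.
  left; apply: sub => /= /(_ I) /eqP; rewrite eqe expf_eq0 (negbTE x0') andbF//.
rewrite probability_setT leNgt => /negP; apply.
apply: (@le_lt_trans _ _ (N01 B + N01 [set 0%R])%E); first exact: measureU2.
by rewrite B0 N0 adde0 lte01.
Qed.

End standard_normal.

Section gaussian_rv_moments.
Context d (Omega : measurableType d) (R : realType) (P : probability Omega R).
Local Notation N01 := (@normal_prob R 0 1).

(** The parameters are chosen before [f], so that one affine image of a standard normal variable
    computes all moments of [Y]. *)
Lemma gaussian_rv_transfer (Y : Omega -> R) : gaussian_rv P Y ->
  exists m s : R, forall f : R -> R, measurable_fun [set: R] f ->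
    N01.-integrable [set: R] (fun x => (f (s * x + m))%:E) ->
    P.-integrable [set: Omega] (fun w => (f (Y w))%:E) /\
    (\int[P]_w (f (Y w))%:E = \int[N01]_x (f (s * x + m))%:E)%E.
Proof.
move=> [mY [m [s [_ lawY]]]]; exists m, s => f mf intf.
pose phi : measurableTypeR R -> measurableTypeR R := fun x => s * x + m.
have mphi : measurable_fun [set: measurableTypeR R] phi by exact: measurable_affine.
pose Z : Omega -> measurableTypeR R := Y.
have mZ : measurable_fun [set: Omega] Z by exact: mY.
have mEf : measurable_fun [set: measurableTypeR R] (fun x => (f x)%:E : \bar R).
  by apply/measurable_EFinP.
have law (A : set (measurableTypeR R)) : measurable A ->
    pushforward P Z A = pushforward N01 phi A.
  by move=> mA; apply: etrans (lawY A mA) _; exact: gaussian_law_affine.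
have tr (g : measurableTypeR R -> \bar R) :
  (\int[pushforward P Z]_x g x = \int[pushforward N01 phi]_x g x)%E.
  by apply: eq_measure_integral => A mA _; exact: (law A mA).
have iY : P.-integrable [set: Omega] (fun w => (f (Y w))%:E).
  apply/integrableP; split.
    by apply/measurable_EFinP; exact: (measurableT_comp mf mY).
  have mag : measurable_fun [set: measurableTypeR R] (fun x => `|(f x)%:E|%E).
    by apply: measurableT_comp.
  have := @ge0_integral_pushforward _ _ _ _ R Z mZ P setT _ measurableT mag
    (fun y _ => abse_ge0 _).
  rewrite preimage_setT /= => <-; rewrite tr.
  have := @ge0_integral_pushforward _ _ _ _ R phi mphi N01 setT _ measurableT mag
    (fun y _ => abse_ge0 _).
  by rewrite preimage_setT /= => ->; case/integrableP: intf.
split => //.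
have := @integral_pushforward _ _ _ _ R Z mZ P setT _ mEf _ measurableT.
rewrite preimage_setT => /(_ iY) /= <-; rewrite tr.
have := @integral_pushforward _ _ _ _ R phi mphi N01 setT _ mEf _ measurableT.
by rewrite preimage_setT => /(_ intf) /= <-.
Qed.

Lemma centered_gaussian_moments (Y : Omega -> R) : gaussian_rv P Y ->
  ('E_P[Y] = 0)%E -> exists s : R, forall n,
    P.-integrable [set: Omega] (fun w => (Y w ^+ n)%:E) /\
    \int[P]_w (Y w ^+ n) = s ^+ n * normal_moment n.
Proof.
move=> /gaussian_rv_transfer[m [s tr]] EY.
have mX n : measurable_fun [set: R] (fun x : R => x ^+ n) by exact: measurable_funX.
(* The transfer at [f = id] identifies E[Y] with [m], as the first normal moment is 0. *)
have m0 : m = 0.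
  have i1 : N01.-integrable [set: R] (fun x => (s * x + m)%:E).
    have := integrableD measurableT
      (integrableZl measurableT s (@integrable_normal_moment R 1))
      (finite_measure_integrable_cst N01 m measurableT).
    by apply: eq_integrable => // x _; rewrite /= expr1 -EFinM -EFinD.
  have [_] := tr id (@measurable_id _ _ setT) i1.
  rewrite -/(expectation P Y) unlock in EY *.
  rewrite EY.
  under eq_integral do rewrite EFinD.
  rewrite integralD//=; last 2 first.
  - have := integrableZl measurableT s (@integrable_normal_moment R 1).
    by apply: eq_integrable => // x _; rewrite /= expr1 -EFinM.
  - exact: finite_measure_integrable_cst.
  have -> : (\int[N01]__ m%:E = m%:E)%E.
    rewrite integral_cst//= [X in (_ * X)%E](_ : _ = 1%E) ?mule1//.
    exact: probability_setT.
  rewrite (eq_integral (fun x : measurableTypeR R => s%:E * (x ^+ 1)%:E)%E); last first.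
    by move=> x _; rewrite expr1 -EFinM.
  rewrite integralZl//; last exact: integrable_normal_moment.
  have fn : (\int[N01]_x (x ^+ 1)%:E)%E \is a fin_num.
    by apply: integrable_fin_num => //; exact: integrable_normal_moment.
  rewrite -(fineK fn) -[fine _]/(normal_moment 1) normal_moment1 mule0 add0e.
  by move=> /(congr1 fine) /= ->.
exists s => n.
have E x : (s * x + m) ^+ n = s ^+ n * x ^+ n by rewrite m0 addr0 exprMn.
have [|iY EYn] := tr (fun x => x ^+ n) (mX n).
  have := integrableZl measurableT (s ^+ n) (@integrable_normal_moment R n).
  by apply: eq_integrable => // x _; rewrite /= E -EFinM.
split => //; rewrite /Rintegral EYn.
under eq_integral do rewrite E.
exact: (RintegralZl (s ^+ n) measurableT (@integrable_normal_moment R n)).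
Qed.

(** The deviation is eliminated through the second moment; the normal moments themselves stay
    unevaluated. *)
Lemma centered_gaussian_even_moment (Y : Omega -> R) (n : nat) :
  gaussian_rv P Y -> ('E_P[Y] = 0)%E ->
  \int[P]_w (Y w ^+ (2 * n)) =
  normal_moment (2 * n) / normal_moment 2 ^+ n * (\int[P]_w (Y w ^+ 2)) ^+ n.
Proof.
move=> gY EY; have [s H] := centered_gaussian_moments gY EY.
rewrite (H (2 * n)%N).2 (H 2%N).2 exprMn -exprM.
have k2 : normal_moment 2 != 0 :> R.
  by rewrite gt_eqF// (normal_moment_even_gt0 1).
by rewrite [RHS]mulrCA divfK// expf_neq0.
Qed.

End gaussian_rv_moments.

(** * Mixed moments of Gaussian pairs *)

Section joint_moment.
Variable R : realType.

Lemma poly_eq_horner (p q : {poly R}) : (forall x, p.[x] = q.[x]) -> p = q.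
Proof.
move=> pq; apply/eqP; rewrite -subr_eq0; apply/negPn/negP => nz.
pose rs : seq R := [seq i%:R | i <- iota 0 (size (p - q))].
have := max_poly_roots nz (rs := rs).
rewrite size_map size_iota ltnn => H; apply: notF; apply: H.
  by apply/allP => x _; rewrite /root !hornerE pq subrr.
by rewrite map_inj_uniq ?iota_uniq// => i j /eqP; rewrite eqr_nat => /eqP.
Qed.

Definition central_coef (n : nat) : R := ((1 + 'X^2 : {poly R}) ^+ n)`_n.

(** Only even powers occur in (1 + X^2)^n. For odd [m] this leaves only odd powers of the covariance
    in [cross_moment]. *)
Lemma central_coefE n : central_coef n = if odd n then 0 else 'C(n, n./2)%:R.
Proof.
rewrite /central_coef addrC exprDn coef_sum.
under eq_bigr => i _ do rewrite expr1n mulr1 -exprM coefMn coefXn.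
have [on|en] := boolP (odd n).
  apply: big1 => i _; case: eqP => [e|]; last by rewrite mul0rn.
  by have := oddM 2 (n - i); rewrite -e on.
have h : (n - n./2 < n.+1)%N by rewrite ltnS leq_subr.
rewrite (bigD1 (Ordinal h)) //= big1 ?addr0.
  have e := even_halfK en; rewrite -mul2n in e.
  have -> : (n - (n - n./2) = n./2)%N by lia.
  by rewrite e eqxx bin_sub//; lia.
move=> i /eqP ne; case: eqP => [e|]; last by rewrite mul0rn.
by case: ne; apply/val_inj => /=; have := ltn_ord i; lia.
Qed.

Lemma central_coef_ge0 n : 0 <= central_coef n.
Proof. by rewrite central_coefE; case: ifP. Qed.

(* Up to a positive constant, [cross_moment m s x] is [E[U^m V^m]] for
   centred jointly Gaussian [U], [V] of variance [s] and covariance [x]. *)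
Definition cross_moment (m : nat) (s x : R) : R :=
  \sum_(j < m.+1) 'C(m, j)%:R * 2 ^+ j * central_coef (m - j)
     * s ^+ (m - j) * x ^+ j.

(** The quadratic form is the variance of a U + V as a polynomial in a, and its m-th power is
    expanded with the term 2 x a split off: a generalised central trinomial coefficient. *)
Lemma coef_quadratic_form (m : nat) (s x : R) :
  ((s%:P * 'X^2 + (2 * x)%:P * 'X + s%:P) ^+ m)`_m = cross_moment m s x.
Proof.
have -> : s%:P * 'X^2 + (2 * x)%:P * 'X + s%:P =
   s%:P * (1 + 'X^2) + (2 * x)%:P * 'X by ring.
rewrite exprDn coef_sum; apply: eq_bigr => j _.
have jm : (j <= m)%N by rewrite -ltnS.
rewrite coefMn !exprMn -!polyC_exp mulrCA -mulrA !coefCM mulrA coefMXn.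
rewrite ltnNge jm /= -/(central_coef _).
rewrite -mulr_natr exprMn; ring.
Qed.

End joint_moment.

Section cross_moments.
Context d (Omega : measurableType d) (R : realType) (P : probability Omega R).
Implicit Types U V : Omega -> R.

Definition centered_gaussian U := gaussian_rv P U /\ ('E_P[U] = 0)%E.

Lemma centered_gaussian_measurable U :
  centered_gaussian U -> measurable_fun [set: Omega] U.
Proof. by case=> -[]. Qed.

Lemma integrable_centered_gaussian_exp U n :
  centered_gaussian U -> P.-integrable [set: Omega] (fun w => (U w ^+ n)%:E).
Proof. by case=> gU EU; have [s /(_ n)[]] := centered_gaussian_moments gU EU. Qed.

(** Dominated by U^(2i) + V^(2j), as |ab| <= a^2 + b^2. *)
Lemma integrable_centered_gaussian_expM U V i j :
  centered_gaussian U -> centered_gaussian V ->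
  P.-integrable [set: Omega] (fun w => (U w ^+ i * V w ^+ j)%:E).
Proof.
move=> gU gV.
have := integrableD measurableT
  (integrable_centered_gaussian_exp (i * 2) gU) (integrable_centered_gaussian_exp (j * 2) gV).
apply: le_integrable => //.
  apply/measurable_EFinP; apply: measurable_funM; apply: measurable_funX.
    exact: centered_gaussian_measurable gU.
  exact: centered_gaussian_measurable gV.
move=> w _; rewrite -EFinD !abse_EFin lee_fin !exprM [leRHS]ger0_norm; last first.
  by rewrite addr_ge0// sqr_ge0.
rewrite normrM -[_ ^+ 2]real_normK ?num_real// -[X in _ + X]real_normK ?num_real//.
have := sqr_ge0 (`|U w ^+ i| - `|V w ^+ j|).
have : 0 <= `|U w ^+ i| * `|V w ^+ j| by rewrite mulr_ge0.
move: (`|U w ^+ i|) (`|V w ^+ j|) => a b; nra.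
Qed.

(** The quotient of normal moments comes from the even moment formula. The binomial coefficient is
    the multiplicity of U^m V^m in the expansion of (a U + V)^(2m). *)
Definition cross_moment_cst (m : nat) : R :=
  normal_moment (2 * m) / normal_moment 2 ^+ m / 'C(2 * m, m)%:R.

Lemma cross_moment_cst_gt0 m : 0 < cross_moment_cst m.
Proof.
rewrite /cross_moment_cst !divr_gt0 ?exprn_gt0 ?normal_moment_even_gt0//.
  exact: (normal_moment_even_gt0 1).
by rewrite ltr0n bin_gt0 leq_pmull.
Qed.

Lemma Rintegral_sum n (f : 'I_n -> Omega -> R) :
  (forall i, P.-integrable [set: Omega] (EFin \o f i)) ->
  \int[P]_w (\sum_(i < n) f i w) = \sum_(i < n) \int[P]_w f i w.
Proof.
move=> intf; rewrite /Rintegral.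
under eq_integral do rewrite -sumEFin.
rewrite integral_sum// -[RHS]/(fine (_)%:E) -sumEFin; congr fine.
apply: eq_bigr => i _; rewrite fineK//.
exact: (integrable_fin_num measurableT (intf i)).
Qed.

(* Both sides of the even moment formula for [a U + V] are polynomials in [a]:
   the coefficients of [a^m] give the mixed moment. *)
Lemma gaussian_cross_moment U V (m : nat) (s x : R) :
  centered_gaussian U -> centered_gaussian V ->
  (forall a, centered_gaussian (fun w => a * U w + V w)) ->
  \int[P]_w (U w ^+ 2) = s -> \int[P]_w (V w ^+ 2) = s ->
  \int[P]_w (U w * V w) = x ->
  \int[P]_w (U w ^+ m * V w ^+ m) = cross_moment_cst m * cross_moment m s x.
Proof.
move=> gU gV gUV EU EV EUV.
pose c : R := normal_moment (2 * m) / normal_moment 2 ^+ m.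
pose M i := \int[P]_w (U w ^+ i * V w ^+ (2 * m - i)).
pose p : {poly R} := \poly_(i < (2 * m).+1) (M i *+ 'C(2 * m, i)).
pose q : {poly R} := c *: (s%:P * 'X^2 + (2 * x)%:P * 'X + s%:P) ^+ m.
have iUV i j := integrable_centered_gaussian_expM i j gU gV.
have /(congr1 (fun r : {poly R} => r`_m)) : p = q.
  apply: poly_eq_horner => a.
  have -> : q.[a] = \int[P]_w ((a * U w + V w) ^+ (2 * m)).
    have [g E] := gUV a.
    rewrite (centered_gaussian_even_moment m g E) /q hornerZ horner_exp.
    congr (_ * _ ^+ _).
    have -> : (s%:P * 'X^2 + (2 * x)%:P * 'X + s%:P).[a] = a ^+ 2 * s + 2 * a * x + s.
      by rewrite !(hornerD, hornerM, hornerC, hornerX, hornerXn); ring.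
    have iZ k i j : P.-integrable [set: Omega] (EFin \o (fun w => k * (U w ^+ i * V w ^+ j))).
      by apply: eq_integrable (integrableZl measurableT k (iUV i j)).
    have i12 : P.-integrable [set: Omega] (EFin \o (fun w =>
        a ^+ 2 * (U w ^+ 2 * V w ^+ 0) + (2 * a) * (U w ^+ 1 * V w ^+ 1))).
      by apply: eq_integrable (integrableD measurableT (iZ (a ^+ 2) 2%N 0%N) (iZ (2 * a) 1%N 1%N)).
    transitivity (\int[P]_w (a ^+ 2 * (U w ^+ 2 * V w ^+ 0) +
        (2 * a) * (U w ^+ 1 * V w ^+ 1) + (U w ^+ 0 * V w ^+ 2))); last first.
      by apply: eq_Rintegral => w _; ring.
    rewrite (RintegralD measurableT i12 (iUV 0%N 2%N)).
    rewrite (RintegralD measurableT (iZ (a ^+ 2) 2%N 0%N) (iZ (2 * a) 1%N 1%N)).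
    rewrite (RintegralZl _ measurableT (iUV 2%N 0%N)) (RintegralZl _ measurableT (iUV 1%N 1%N)).
    congr (_ * _ + _ * _ + _).
    - by rewrite -EU; apply: eq_Rintegral => w _; rewrite mulr1.
    - by rewrite -EUV.
    - by rewrite -EV; apply: eq_Rintegral => w _; rewrite mul1r.
  rewrite horner_poly.
  under [RHS]eq_Rintegral => w _.
    rewrite addrC exprDn.
    under eq_bigr => i _ do rewrite exprMn -mulr_natr mulrCA -mulrA
       (mulrC (V w ^+ _)) mulrA.
    over.
  rewrite Rintegral_sum; last first.
    move=> i; apply: eq_integrable (integrableZl measurableT (a ^+ i * 'C(2 * m, i)%:R) (iUV i (2 * m - i)%N)) => //.
    by move=> w _; rewrite /= -EFinM; congr (_%:E); ring.
  apply: eq_bigr => i _.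
  transitivity (a ^+ i * 'C(2 * m, i)%:R * M i); first by ring.
  rewrite /M -(RintegralZl _ measurableT (iUV i (2 * m - i)%N)).
  by apply: eq_Rintegral => w _; ring.
rewrite coefZ coef_quadratic_form coef_poly ifT; last by rewrite ltnS leq_pmull.
rewrite /M mul2n -addnn addnK => E.
have b0 : 'C(m + m, m)%:R != 0 :> R by rewrite pnatr_eq0 -lt0n bin_gt0 leq_addr.
apply: (mulIf b0); rewrite mulr_natr E /cross_moment_cst -/c mul2n -addnn.
by rewrite [RHS]mulrAC divfK.
Qed.

End cross_moments.

(** * Increments of a Gaussian process *)

Section process.
Context d (Omega : measurableType d) (R : realType) (P : probability Omega R).
Variables (D : set R) (X : R -> Omega -> R) (v : R -> R).
Hypotheses (X_gauss : gaussian_process P D X) (X_centered : centered P D X)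
  (X_incr : increments_variance P D X v).

Lemma gaussian_process_single t : D t -> centered_gaussian P (X t).
Proof.
move=> Dt; split; last exact: X_centered.
have := @X_gauss 1 (fun=> t) (fun=> 1) (fun=> Dt).
by under eq_fun do rewrite big_ord1 mul1r.
Qed.

Lemma gaussian_process_integrable t :
  D t -> P.-integrable [set: Omega] (EFin \o X t).
Proof.
move=> Dt.
have := integrable_centered_gaussian_exp 1 (gaussian_process_single Dt).
by apply: eq_integrable => // w _; rewrite expr1.
Qed.

Lemma gaussian_process_comb (n : nat) (t a : 'I_n -> R) :
  (forall i, D (t i)) ->
  centered_gaussian P (fun w => \sum_(i < n) a i * X (t i) w).
Proof.
move=> Dt; split; first exact: X_gauss.
rewrite unlock.
have iX i := gaussian_process_integrable (Dt i).
have iaX i : P.-integrable [set: Omega] (EFin \o (fun w => a i * X (t i) w)).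
  by apply: eq_integrable (integrableZl measurableT (a i) (iX i)).
under eq_integral do rewrite -sumEFin.
rewrite integral_sum// big1// => i _.
under eq_integral do rewrite EFinM.
rewrite integralZl//; last exact: iX.
by have := X_centered (Dt i); rewrite unlock => ->; rewrite mule0.
Qed.

Lemma gaussian_increment s t : D s -> D t ->
  centered_gaussian P (fun w => X t w - X s w).
Proof.
move=> Ds Dt.
pose ts := [tuple t; s]; pose cs : 2.-tuple R := [tuple 1; -1].
have := @gaussian_process_comb 2 (tnth ts) (tnth cs).
rewrite [Y in (_ -> centered_gaussian _ Y) -> _](_ : _ = (fun w => X t w - X s w)).
  by apply; case=> -[|[|//]] i.
by apply/funext => w; rewrite !big_ord_recl big_ord0 /= !(tnth_nth 0)/=; ring.
Qed.

Lemma gaussian_increment_comb s t s' t' a : D s -> D t -> D s' -> D t' ->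
  centered_gaussian P (fun w => a * (X t w - X s w) + (X t' w - X s' w)).
Proof.
move=> Ds Dt Ds' Dt'.
pose ts := [tuple t; s; t'; s']; pose cs : 4.-tuple R := [tuple a; - a; 1; -1].
have := @gaussian_process_comb 4 (tnth ts) (tnth cs).
rewrite [Y in (_ -> centered_gaussian _ Y) -> _](_ : _ =
   (fun w => a * (X t w - X s w) + (X t' w - X s' w))).
  by apply; case=> -[|[|[|[|//]]]] i.
by apply/funext => w; rewrite !big_ord_recl big_ord0 /= !(tnth_nth 0)/=; ring.
Qed.

Lemma increment_second_moment s t : D s -> D t ->
  \int[P]_w ((X t w - X s w) ^+ 2) = v `|t - s|.
Proof.
by move=> Ds Dt; have := X_incr Ds Dt; rewrite unlock /Rintegral => ->.
Qed.

(** Polarisation: 2 (t - s)(t' - s') = (t' - s)^2 + (t - s')^2 - (t' - t)^2 - (s' - s)^2, read for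
    the values of the process, leaves only squares of increments. *)
Lemma increments_covariance s t s' t' : D s -> D t -> D s' -> D t' ->
  \int[P]_w ((X t w - X s w) * (X t' w - X s' w)) =
  2^-1 * (v `|t' - s| + v `|t - s'| - v `|t' - t| - v `|s' - s|).
Proof.
move=> Ds Dt Ds' Dt'.
have i2 x y : D x -> D y ->
    P.-integrable [set: Omega] (EFin \o (fun w => (X y w - X x w) ^+ 2)).
  by move=> Dx Dy; exact: (integrable_centered_gaussian_exp 2 (gaussian_increment Dx Dy)).
rewrite -!increment_second_moment//.
rewrite -RintegralD ?i2// -RintegralB ?i2//; last first.
  by apply: eq_integrable (integrableD measurableT (i2 _ _ Ds Dt') (i2 _ _ Ds' Dt)).
have i3 := integrableB measurableT
  (integrableD measurableT (i2 _ _ Ds Dt') (i2 _ _ Ds' Dt)) (i2 _ _ Dt Dt').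
rewrite -RintegralB ?i2// -RintegralZl//; last first.
  by apply: eq_integrable (integrableB measurableT i3 (i2 _ _ Ds Ds')).
by apply: eq_Rintegral => w _; field.
Qed.

(** Serves to bound mean absolute increments below: a controlled fourth moment prevents the variance
    from sitting on rare large values. *)
Lemma increment_fourth_moment s t : D s -> D t ->
  \int[P]_w ((X t w - X s w) ^+ 4) =
  normal_moment 4 / normal_moment 2 ^+ 2 * v `|t - s| ^+ 2.
Proof.
move=> Ds Dt; have [g e] := gaussian_increment Ds Dt.
by rewrite -increment_second_moment// (centered_gaussian_even_moment 2 g e).
Qed.

Lemma increments_cross_moment m s t s' t' : D s -> D t -> D s' -> D t' ->
  `|t - s| = `|t' - s'| ->
  \int[P]_w ((X t w - X s w) ^+ m * (X t' w - X s' w) ^+ m) =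
  cross_moment_cst R m * cross_moment m (v `|t - s|)
    (2^-1 * (v `|t' - s| + v `|t - s'| - v `|t' - t| - v `|s' - s|)).
Proof.
move=> Ds Dt Ds' Dt' e; apply: gaussian_cross_moment.
- exact: gaussian_increment.
- exact: gaussian_increment.
- by move=> a; exact: gaussian_increment_comb.
- exact: increment_second_moment.
- by rewrite e; exact: increment_second_moment.
- exact: increments_covariance.
Qed.

End process.

(** * Inequalities for the mixed moment polynomial *)

Section cross_moment_inequalities.
Variable R : realType.

Lemma exprD_superadd k (A B : R) : 0 <= A -> 0 <= B ->
  A ^+ k.+1 + B ^+ k.+1 <= (A + B) ^+ k.+1.
Proof.
move=> A0 B0; elim: k => [|k IH]; first by rewrite !expr1.
rewrite exprS [B ^+ _]exprS [leRHS]exprS mulrDl; apply: lerD.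
  by rewrite ler_wpM2l//; apply: le_trans IH; rewrite lerDl exprn_ge0.
by rewrite ler_wpM2l//; apply: le_trans IH; rewrite lerDr exprn_ge0.
Qed.

(* Spreading apart two numbers with a given sum increases the sum of their
   powers; the lower one may become negative, hence no convexity argument. *)
Lemma expr_spread k (S1 S2 dd : R) : 0 <= S2 -> S2 <= S1 -> 0 <= dd ->
  S1 ^+ k + S2 ^+ k <= (S1 + dd) ^+ k + (S2 - dd) ^+ k.
Proof.
move=> S20 S12 d0.
rewrite -subr_ge0.
have -> : (S1 + dd) ^+ k + (S2 - dd) ^+ k - (S1 ^+ k + S2 ^+ k) =
   ((S1 + dd) ^+ k - S1 ^+ k) + ((S2 - dd) ^+ k - S2 ^+ k) by ring.
rewrite !subrXX.
have -> : S1 + dd - S1 = dd by ring.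
have -> : S2 - dd - S2 = - dd by ring.
rewrite mulNr -mulrBr mulr_ge0// subr_ge0; apply: ler_sum => i _.
apply: le_trans (ler_norm _) _; rewrite normrM !normrX.
have h1 : `|S2 - dd| <= S1 + dd by rewrite ler_norml; apply/andP; split; lra.
have h2 : `|S2| <= S1 by rewrite ger0_norm.
by apply: ler_pM; rewrite ?exprn_ge0//; apply: lerXn2r; rewrite ?nnegrE// ?addr_ge0// (le_trans S20).
Qed.

(** The exact gain is 3 dd (S1^2 - S2^2) + 3 dd^2 (S1 + S2), and S1 >= dd turns the last term into
    at least 3 dd^3. First powers would gain nothing. *)
Lemma expr3_spread (S1 S2 dd : R) : 0 <= S2 -> S2 <= S1 -> 0 <= dd -> dd <= S1 ->
  S1 ^+ 3 + S2 ^+ 3 + 3 * dd ^+ 3 <= (S1 + dd) ^+ 3 + (S2 - dd) ^+ 3.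
Proof.
move=> S20 S12 d0 dS1; rewrite -subr_ge0.
have -> : (S1 + dd) ^+ 3 + (S2 - dd) ^+ 3 - (S1 ^+ 3 + S2 ^+ 3 + 3 * dd ^+ 3) =
  3 * dd * ((S1 - S2) * (S1 + S2) + dd * (S1 - dd) + dd * S2) by ring.
rewrite !mulr_ge0// !addr_ge0// mulr_ge0//; rewrite ?subr_ge0// ?addr_ge0//; lra.
Qed.

Section fixed_order.
Variables (m : nat) (s : R).
Hypotheses (m_odd : odd m) (m_gt1 : (1 < m)%N) (s0 : 0 <= s).

Definition cross_coef (j : nat) : R :=
  'C(m, j)%:R * 2 ^+ j * central_coef R (m - j) * s ^+ (m - j).

Lemma cross_coef_ge0 j : 0 <= cross_coef j.
Proof. by rewrite /cross_coef !mulr_ge0// ?exprn_ge0// central_coef_ge0. Qed.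

Lemma cross_coef_even j : (j <= m)%N -> ~~ odd j -> cross_coef j = 0.
Proof.
move=> jm ej; rewrite /cross_coef central_coefE oddB// m_odd (negbTE ej) /=.
by rewrite mulr0 mul0r.
Qed.

Lemma cross_momentE x :
  cross_moment m s x = \sum_(j < m.+1) cross_coef j * x ^+ j.
Proof. by []. Qed.

Lemma cross_momentN x : cross_moment m s (- x) = - cross_moment m s x.
Proof.
rewrite !cross_momentE -sumrN; apply: eq_bigr => j _.
have [oj|ej] := boolP (odd j).
  by rewrite exprNn -signr_odd oj expr1 mulN1r mulrN.
by rewrite cross_coef_even ?mul0r ?oppr0// -ltnS.
Qed.

Lemma cross_moment_ge0 x : 0 <= x -> 0 <= cross_moment m s x.
Proof.
move=> x0; rewrite cross_momentE sumr_ge0// => j _.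
by rewrite mulr_ge0 ?cross_coef_ge0// exprn_ge0.
Qed.

Lemma cross_moment_superadd A B : 0 <= A -> 0 <= B ->
  cross_moment m s A + cross_moment m s B <= cross_moment m s (A + B).
Proof.
move=> A0 B0; rewrite !cross_momentE -big_split/=; apply: ler_sum => -[[|j] jm] _.
  (* A positive constant term would break superadditivity; it vanishes because [m] is odd. *)
  by rewrite /= (@cross_coef_even 0)// !mul0r addr0.
by rewrite -mulrDr ler_wpM2l ?cross_coef_ge0// exprD_superadd.
Qed.

Lemma norm_cross_moment_mono x B : `|x| <= B ->
  `|cross_moment m s x| <= cross_moment m s B.
Proof.
move=> xB; rewrite !cross_momentE (le_trans (ler_norm_sum _ _ _))//.
apply: ler_sum => j _; rewrite normrM ger0_norm ?cross_coef_ge0//.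
rewrite ler_wpM2l ?cross_coef_ge0// normrX; apply: lerXn2r => //.
by rewrite nnegrE (le_trans _ xB).
Qed.

Lemma measurable_cross_moment : measurable_fun [set: R] (cross_moment m s).
Proof.
by apply: measurable_sum => j; exact: measurable_funM.
Qed.

Lemma cross_moment_mono A B : 0 <= A -> A <= B ->
  cross_moment m s A <= cross_moment m s B.
Proof.
move=> A0 AB; rewrite !cross_momentE; apply: ler_sum => j _.
rewrite ler_wpM2l ?cross_coef_ge0//; apply: lerXn2r => //.
by rewrite nnegrE (le_trans A0).
Qed.

(** Coefficient of s^(m-3) x^3 in [cross_moment m s x]. *)
Definition cubic_cst : R := 'C(m, 3)%:R * 2 ^+ 3 * central_coef R (m - 3).

(** No power loses under spreading, and of the gains only the cubic one is kept; the cubic term is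
    present since an odd m > 1 is at least 3. *)
Lemma cross_moment_spread (S1 S2 dd : R) : 0 <= S2 -> S2 <= S1 -> 0 <= dd -> dd <= S1 ->
  cross_moment m s S1 + cross_moment m s S2 + 3 * cubic_cst * s ^+ (m - 3) * dd ^+ 3 <=
  cross_moment m s (S1 + dd) + cross_moment m s (S2 - dd).
Proof.
move=> S20 S12 d0 dS1; rewrite !cross_momentE -!big_split/=.
have m3 : (3 < m.+1)%N by case: m m_odd m_gt1 => [|[|[|n]]].
rewrite (bigD1 (Ordinal m3))//= [leRHS](bigD1 (Ordinal m3))//= [leLHS]addrAC; apply: lerD.
  have -> : 3 * cubic_cst * s ^+ (m - 3) = 3 * cross_coef 3 by rewrite /cross_coef /cubic_cst; ring.
  rewrite -!mulrDr -mulrA mulrCA -mulrDr ler_wpM2l ?cross_coef_ge0//.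
  exact: expr3_spread.
apply: ler_sum => j _; rewrite -!mulrDr ler_wpM2l ?cross_coef_ge0//.
exact: expr_spread.
Qed.

End fixed_order.

Lemma cubic_cst_gt0 m : odd m -> (1 < m)%N -> 0 < cubic_cst m.
Proof.
move=> m_odd m_gt1.
have m3 : (3 <= m)%N by case: m m_odd m_gt1 => [|[|[|n]]].
rewrite /cubic_cst !mulr_gt0 ?exprn_gt0 ?ltr0n ?bin_gt0//.
by rewrite central_coefE oddB// m_odd /= ltr0n bin_gt0; lia.
Qed.

Lemma cubic_cst_ge0 m : 0 <= cubic_cst m.
Proof. by rewrite /cubic_cst !mulr_ge0 ?exprn_ge0 ?central_coef_ge0. Qed.

(** This is [cross_moment m 1 1]. *)
Definition linear_cst (m : nat) : R := \sum_(j < m.+1) cross_coef m 1 j.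

Lemma linear_cst_ge0 m : 0 <= linear_cst m.
Proof. by rewrite sumr_ge0// => j _; exact: cross_coef_ge0. Qed.

(** The polynomial is homogeneous of degree m in (s, x) and has no constant term in x: one factor
    |x| is kept and the others are replaced by s. *)
Lemma norm_cross_moment_le m (s x : R) : odd m -> `|x| <= s ->
  `|cross_moment m s x| <= linear_cst m * s ^+ m.-1 * `|x|.
Proof.
move=> om xs; have s0 : 0 <= s by apply: le_trans xs.
rewrite cross_momentE (le_trans (ler_norm_sum _ _ _))// /linear_cst !mulr_suml.
apply: ler_sum => -[[|j] jm] _.
  by rewrite /= !(@cross_coef_even _ _ om 0)// !mul0r normr0.
rewrite normrM ger0_norm ?cross_coef_ge0// /cross_coef expr1n mulr1.
rewrite -!mulrA !ler_wpM2l ?exprn_ge0 ?central_coef_ge0//.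
rewrite normrX exprSr mulrA ler_wpM2r//=.
rewrite (_ : m.-1 = (m - j.+1 + j)%N); last by move: jm; rewrite ltnS; lia.
rewrite exprD ler_wpM2l ?exprn_ge0//; apply: lerXn2r => //.
Qed.

End cross_moment_inequalities.

(** * Integrals of the covariance kernel *)

Section indicator_integrals.
Context {R : realType}.
Local Notation mu := (@lebesgue_measure R).
Implicit Types (a b y : R) (f A : R -> R).

(** Intervals enter as factors, not as domains of integration: integrands over shifted or
    overlapping intervals can then be compared pointwise on the whole line. *)
Definition box a b (u : R) : R := \1_(`[a, b]%classic) u.

Lemma boxE a b u : box a b u = ((a <= u) && (u <= b))%:R.
Proof. by rewrite /box indicE mem_setE in_itv. Qed.

Lemma measurable_box a b : measurable_fun [set: R] (box a b).
Proof. exact: measurable_indic. Qed.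

Lemma integrable_box a b f (M : R) : measurable_fun [set: R] f ->
  (forall u, a <= u -> u <= b -> `|f u| <= M) ->
  mu.-integrable [set: R] (EFin \o (fun u => box a b u * f u)).
Proof.
move=> mf fM.
have := integrableZl measurableT M (integrable_indic_itv a b true false).
apply: le_integrable => //.
  by apply/measurable_EFinP; apply: measurable_funM => //; exact: measurable_box.
move=> u _; rewrite /= lee_fin normrM -/(box a b u) boxE.
case: andP => [[au ub]|_]; last by rewrite normr0 mul0r.
rewrite normr1 mul1r normrM normr1 mulr1.
by apply: le_trans (ler_norm _); exact: fM.
Qed.

Lemma Rintegral_box a b f :
  \int[mu]_(u in `[a, b]) f u = \int[mu]_u (box a b u * f u).
Proof.
rewrite Rintegral_mkcond; apply: eq_Rintegral => u _.
by rewrite patchE /box indicE; case: (u \in _); rewrite ?mul1r ?mul0r.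
Qed.

Lemma Rintegral_box1 a b : a <= b -> \int[mu]_u box a b u = b - a.
Proof.
move=> ab; transitivity (\int[mu]_(u in `[a, b]) (1 : R)).
  by rewrite Rintegral_box; apply: eq_Rintegral => u _; rewrite mulr1.
rewrite Rintegral_cst// mul1r [X in fine X](_ : _ = (b - a)%:E)//.
apply: etrans (lebesgue_measure_itv _) _ => /=; rewrite lte_fin -EFinB.
by case: ltP => //= ba; congr (_%:E); apply/esym/eqP; rewrite subr_eq0 eq_le ab ba.
Qed.

(** Covers translations and reflections at once; the nonnegative change of variables is applied to
    the positive and negative parts. *)
Lemma Rintegral_isometry (a b : R) f : `|a| = 1 -> measurable_fun [set: R] f ->
  \int[mu]_u f (a * u + b) = \int[mu]_u f u.
Proof.
move=> a1 mf; have a0 : a != 0 by rewrite -normr_eq0 a1 oner_eq0.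
have mEf : measurable_fun [set: R] (EFin \o f) by exact/measurable_EFinP.
rewrite /Rintegral; congr fine; rewrite [LHS]integralE [RHS]integralE.
pose phi (u : R) : R := a * u + b.
have h1 := @ge0_integral_affine R a b _ a0 (measurable_funepos mEf) (fun x => funepos_ge0 _ x).
have h2 := @ge0_integral_affine R a b _ a0 (measurable_funeneg mEf) (fun x => funeneg_ge0 _ x).
rewrite a1 invr1 !mul1e in h1 h2; congr (_ - _)%E.
  rewrite -[RHS]h1; apply: eq_integral => x _.
  exact: (congr1 (fun g => g x) (@funepos_comp _ _ _ (EFin \o f) phi)).
rewrite -[RHS]h2; apply: eq_integral => x _.
exact: (congr1 (fun g => g x) (@funeneg_comp _ _ _ (EFin \o f) phi)).
Qed.

Lemma Rintegral_box_reflect a b c f : measurable_fun [set: R] f ->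
  \int[mu]_u (box a b u * f (c - u)) = \int[mu]_u (box (c - b) (c - a) u * f u).
Proof.
move=> mf; have mb : measurable_fun [set: R] (fun u => box (c - b) (c - a) u * f u).
  by apply: measurable_funM => //; exact: measurable_box.
rewrite -(@Rintegral_isometry (-1) c _ _ mb) ?normrN1//.
apply: eq_Rintegral => u _; rewrite mulN1r addrC; congr (_ * _); rewrite !boxE.
by congr (_%:R); rewrite [- u + c]addrC lerD2l lerN2 lerD2l lerN2 andbC.
Qed.

Lemma Rintegral_box_shift a b c f : measurable_fun [set: R] f ->
  \int[mu]_u (box a b u * f (u - c)) = \int[mu]_u (box (a - c) (b - c) u * f u).
Proof.
move=> mf; have mb : measurable_fun [set: R] (fun u => box (a - c) (b - c) u * f u).
  by apply: measurable_funM => //; exact: measurable_box.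
rewrite -(@Rintegral_isometry 1 (- c) _ _ mb) ?normr1//.
apply: eq_Rintegral => u _; rewrite mul1r; congr (_ * _); rewrite !boxE.
by rewrite !lerD2r.
Qed.

(** Translation carries [e, y] to [0, y - e], a part of [0, y]. This gives telescoping differences a
    signed integral. *)
Lemma Rintegral_box_shift_le A (M e y : R) : measurable_fun [set: R] A ->
  (forall u, 0 <= A u <= M) -> 0 <= e ->
  \int[mu]_u (box e y u * A (u - e)) <= \int[mu]_u (box 0 y u * A u).
Proof.
move=> mA A0 e0; rewrite Rintegral_box_shift// subrr.
have AM u : `|A u| <= M by have /andP[h1 h2] := A0 u; rewrite ger0_norm.
apply: le_Rintegral => //; try exact: (@integrable_box _ _ _ M).
move=> u _; rewrite !boxE; have /andP[h _] := A0 u.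
case: (leP 0 u) => //= u0; rewrite ?mul0r//.
case: (leP u (y - e)) => h1; rewrite ?mul0r ?mul1r.
  by rewrite (_ : u <= y) ?mul1r//; lra.
by rewrite mulr_ge0.
Qed.

End indicator_integrals.

(** * Bounds for the covariance kernel along a line *)

Section kernel_integral.
Context {R : realType}.
Local Notation mu := (@lebesgue_measure R).
Variables (V : R -> R) (L : R) (m : nat).
Hypotheses (V0 : V 0 = 0) (V_homo : {homo V : a b / a <= b})
  (V_ge0 : forall r, 0 <= V r) (V_le : forall r, V r <= V L)
  (V_incr : forall a b h : R, 0 <= a -> a <= b -> 0 <= h -> b + h <= L ->
     V (b + h) - V b <= V (a + h) - V a)
  (m_odd : odd m) (m_gt1 : (1 < m)%N).

(* The covariance of two increments of length [e] whose starting times are at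
   distance [u]. *)
Definition theta (e u : R) : R := 2^-1 * (V `|u + e| + V `|u - e| - 2 * V `|u|).

Lemma thetaN e u : theta e (- u) = theta e u.
Proof.
rewrite /theta normrN; have -> : - u + e = - (u - e) by ring.
have -> : - u - e = - (u + e) by ring.
by rewrite !normrN [V _ + V _]addrC.
Qed.

Lemma measurable_V : measurable_fun [set: R] V.
Proof. by apply: nondecreasing_measurable => // a b _ _; exact: V_homo. Qed.

Lemma measurable_Vnorm c : measurable_fun [set: R] (fun u => V `|u + c|).
Proof.
apply: (measurableT_comp measurable_V); apply: measurableT_comp => //.
exact: measurable_funD.
Qed.

Lemma measurable_theta e : measurable_fun [set: R] (theta e).
Proof.
apply: measurable_funM => //; apply: measurable_funB.
  by apply: measurable_funD; exact: measurable_Vnorm.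
by apply: measurable_funM => //; exact: (measurableT_comp measurable_V).
Qed.

Variable e : R.
Hypotheses (e0 : 0 < e) (e2L : e + e <= L).

Let s := V e.
Let G := cross_moment m s.
(** Concavity makes [w] nonincreasing for nonnegative u with u + e <= L. [B] will be the telescoping
    part of the kernel [H], and [f] what is left of it near the diagonal. *)
Let w (u : R) := 2^-1 * (V (u + e) - V u).
Let dd (u : R) := 2^-1 * (V (e - u) - V u).
Let B (u : R) := G (w u).
Let H (u : R) := G (theta e u).
Let f (u : R) := H u - B u.

Let s_ge0 : 0 <= s. Proof. exact: V_ge0. Qed.

Let w_ge0 u : 0 <= w u.
Proof. by rewrite mulr_ge0// subr_ge0; apply: V_homo; rewrite lerDl ltW. Qed.

Let w_le (u : R) : 0 <= u -> u + e <= L -> w u <= 2^-1 * s.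
Proof.
move=> u0 uL; rewrite ler_wpM2l//.
by have := V_incr (lexx 0) u0 (ltW e0) uL; rewrite add0r V0 subr0.
Qed.

Let w_mono (a b : R) : 0 <= a -> a <= b -> b + e <= L -> w b <= w a.
Proof.
by move=> a0 ab bL; rewrite ler_wpM2l//; exact: V_incr (ltW e0) bL.
Qed.

Let theta_near (u : R) : 0 <= u -> u <= e -> theta e u = w u + dd u.
Proof.
move=> u0 ue; rewrite /theta /w /dd (ger0_norm u0) ger0_norm ?addr_ge0// ?(ltW e0)//.
by rewrite distrC ger0_norm ?subr_ge0//; ring.
Qed.

Let theta_far (u : R) : e <= u -> theta e u = - (w (u - e) - w u).
Proof.
move=> eu; have u0 : 0 <= u by apply: le_trans eu; exact: ltW.
rewrite /theta /w (ger0_norm u0) ger0_norm ?addr_ge0// ?(ltW e0)//.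
by rewrite ger0_norm ?subr_ge0// subrK; field.
Qed.

(** The Cauchy-Schwarz bound for two increments of variance s, here derived from monotonicity and
    concavity: [w] lies in [0, s/2], and |dd| <= s/2 near the diagonal. *)
Let theta_le (u : R) : 0 <= u -> u + e <= L -> `|theta e u| <= s.
Proof.
have e0' := e0; have e2L' := e2L.
move=> u0 uL; have := s_ge0; have [ue|eu] := leP u e.
  have := w_ge0 u; have := w_le u0 uL; rewrite theta_near//.
  have h1 : V u <= s by exact: V_homo.
  have h2 : V (e - u) <= s by apply: V_homo; lra.
  have h3 := V_ge0 u; have h4 := V_ge0 (e - u).
  move=> *; rewrite ler_norml /dd; apply/andP; split; lra.
rewrite theta_far ?(ltW eu)// normrN.
have h0 : 0 <= u - e by lra.
have h1 : w (u - e) <= 2^-1 * s by apply: w_le => //; lra.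
have h2 : w u <= w (u - e) by apply: w_mono => //; lra.
have := w_ge0 u; have := w_ge0 (u - e) => *.
by rewrite ler_norml; apply/andP; split; lra.
Qed.

Let measurable_w : measurable_fun [set: R] w.
Proof.
apply: measurable_funM => //; apply: measurable_funB; last exact: measurable_V.
by apply: (measurableT_comp measurable_V); exact: measurable_funD.
Qed.

Let measurable_B : measurable_fun [set: R] B.
Proof. by apply: measurableT_comp measurable_w; exact: measurable_cross_moment. Qed.

Let measurable_H : measurable_fun [set: R] H.
Proof.
by apply: measurableT_comp (measurable_theta e); exact: measurable_cross_moment.
Qed.

Let measurable_f : measurable_fun [set: R] f.
Proof. exact: measurable_funB. Qed.

Let B_bounds u : 0 <= B u <= G (2 * V L).
Proof.
rewrite cross_moment_ge0//=; apply: cross_moment_mono => //.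
have := V_le (u + e); have := V_ge0 u; have := V_ge0 (u + e) => *.
rewrite /w; lra.
Qed.

Let H_bound u : `|H u| <= G (2 * V L).
Proof.
apply: norm_cross_moment_mono => //; rewrite /theta ler_norml.
have := V_le `|u + e|; have := V_ge0 `|u + e|.
have := V_le `|u - e|; have := V_ge0 `|u - e|.
have := V_le `|u|; have := V_ge0 `|u| => *.
by apply/andP; split; lra.
Qed.

Let f_bound u : `|f u| <= 2 * G (2 * V L).
Proof.
have := H_bound u; rewrite /f !ler_norml => /andP[h1 h2].
by have /andP[h3 h4] := B_bounds u; apply/andP; split; lra.
Qed.

Let coef_ge0 : 0 <= 3 * cubic_cst R m * s ^+ (m - 3).
Proof.
apply: mulr_ge0; last exact: exprn_ge0.
by apply: mulr_ge0 => //; exact: cubic_cst_ge0.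
Qed.

(** At u and its mirror image e - u, [theta] is [w u + dd u] and [w (e - u) - dd u]: passing from
    [w] to [theta] raises the larger value and lowers the smaller one by the same amount. *)
Let f_spread (u : R) : 0 <= u -> u <= e - u ->
  3 * cubic_cst R m * s ^+ (m - 3) * dd u ^+ 3 <= f u + f (e - u).
Proof.
have e0' := e0; have e2L' := e2L.
move=> u0 ue.
have d0 : 0 <= dd u by rewrite mulr_ge0// subr_ge0; exact: V_homo.
have w1 : w (e - u) <= w u by apply: w_mono => //; lra.
have dw : dd u <= w u by rewrite ler_wpM2l// lerD2r; apply: V_homo; lra.
have := cross_moment_spread m_odd m_gt1 s_ge0 (w_ge0 _) w1 d0 dw.
rewrite /f /H /B (@theta_near u)//; last by lra.
rewrite (@theta_near (e - u)); [|lra|lra].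
have -> : dd (e - u) = - dd u by rewrite /dd (_ : e - (e - u) = u); ring.
rewrite /G; lra.
Qed.

(** For the points of the first half whose mirror image is cut off by the end of the line. *)
Let f_ge0 (u : R) : 0 <= u -> u <= e - u -> 0 <= f u.
Proof.
have e0' := e0; have e2L' := e2L.
move=> u0 ue; rewrite /f /H /B subr_ge0 theta_near//; last by lra.
have d0 : 0 <= dd u by rewrite mulr_ge0// subr_ge0; exact: V_homo.
by apply: cross_moment_mono => //; rewrite lerDl.
Qed.

Let f_spread_ge0 (u : R) : 0 <= u -> u <= e -> 0 <= f u + f (e - u).
Proof.
have e0' := e0; have e2L' := e2L.
wlog ue : u / u <= e - u => [wl u0 u1|u0 u1].
  have [h|h] := leP u (e - u); first exact: wl.
  have := wl (e - u); rewrite (_ : e - (e - u) = u); last by ring.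
  by move=> h'; rewrite addrC; apply: h'; lra.
apply: le_trans (f_spread u0 ue).
apply: mulr_ge0 => //; apply: exprn_ge0.
by rewrite mulr_ge0// subr_ge0; exact: V_homo.
Qed.

(* Near the diagonal [theta] is [w + dd] and [dd] is odd about [e / 2]; away
   from it [theta] is [- (w (u - e) - w u)], so that superadditivity of [G]
   bounds its negative part by a telescoping difference of [B]. *)
Let H_ge (y u : R) : y + e <= L ->
  box 0 y u * (box 0 e u * f u) + (box 0 y u * B u - box e y u * B (u - e)) <=
  box 0 y u * H u.
Proof.
have e0' := e0; have e2L' := e2L.
move=> yL; rewrite !boxE.
have [u0|u0] := ltP u 0; first by rewrite (lt_geF (lt_trans u0 e0)) !mul0r; lra.
have [uy|uy] := leP u y; last by rewrite !andbF !mul0r; lra.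
have /andP[Be _] := B_bounds (u - e).
have [ue|eu|ue] := ltgtP u e; rewrite /= ?mul1r ?mul0r /f; [lra| |lra].
rewrite add0r /H theta_far ?(ltW eu)// /G cross_momentN// -/G.
have w1 : w u <= w (u - e) by apply: w_mono; lra.
have := @cross_moment_superadd R m s m_odd s_ge0 (w (u - e) - w u) (w u).
rewrite subrK subr_ge0 => /(_ w1 (w_ge0 u)); rewrite /B /G; lra.
Qed.

Let integrable_boxB y : mu.-integrable [set: R] (EFin \o (fun u => box 0 y u * B u)).
Proof.
apply: (@integrable_box _ _ _ _ (G (2 * V L))) => // u _ _.
by have /andP[h1 h2] := B_bounds u; rewrite ger0_norm.
Qed.

Let integrable_boxBe y :
  mu.-integrable [set: R] (EFin \o (fun u => box e y u * B (u - e))).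
Proof.
apply: (@integrable_box _ _ _ (fun u => B (u - e)) (G (2 * V L))) => [|u _ _].
  by apply: (measurableT_comp measurable_B); exact: measurable_funB.
by have /andP[h1 h2] := B_bounds (u - e); rewrite ger0_norm.
Qed.

Let integrable_boxH y : mu.-integrable [set: R] (EFin \o (fun u => box 0 y u * H u)).
Proof. by apply: (@integrable_box _ _ _ _ (G (2 * V L))) => // u _ _. Qed.

Let measurable_boxf y : measurable_fun [set: R] (fun u => box 0 y u * f u).
Proof. by apply: measurable_funM => //; exact: measurable_box. Qed.

Let boxf_bound y u : `|box 0 y u * f u| <= 2 * G (2 * V L).
Proof.
rewrite boxE normrM; case: (_ && _); rewrite ?normr1 ?mul1r ?f_bound//.
rewrite normr0 mul0r (le_trans _ (f_bound u))//.
Qed.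

Let integrable_boxf y :
  mu.-integrable [set: R] (EFin \o (fun u => box 0 e u * (box 0 y u * f u))).
Proof. by apply: integrable_box (fun u _ _ => boxf_bound y u). Qed.

Let Rintegral_boxH_ge y : y + e <= L ->
  \int[mu]_u (box 0 e u * (box 0 y u * f u)) <= \int[mu]_u (box 0 y u * H u).
Proof.
move=> yL.
have h := @Rintegral_box_shift_le R B _ e y measurable_B B_bounds (ltW e0).
pose F u := box 0 e u * (box 0 y u * f u) + (box 0 y u * B u - box e y u * B (u - e)).
have iF2 : mu.-integrable [set: R] (EFin \o (fun u => box 0 y u * B u - box e y u * B (u - e))).
  by apply: eq_integrable (integrableB measurableT (integrable_boxB y) (integrable_boxBe y)).
have iF : mu.-integrable [set: R] (EFin \o F).
  by apply: eq_integrable (integrableD measurableT (integrable_boxf y) iF2).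
have : \int[mu]_u F u <= \int[mu]_u (box 0 y u * H u).
  apply: le_Rintegral => // u _; rewrite /F mulrCA; exact: H_ge.
rewrite (RintegralD measurableT (integrable_boxf y) iF2).
rewrite (RintegralB measurableT (integrable_boxB y) (integrable_boxBe y)).
lra.
Qed.

(** The reflection of [0, e] in its midpoint exhibits the pairs [f u + f (e - u)]. *)
Let Rintegral_boxf_sym y :
  \int[mu]_u (box 0 e u * (box 0 y u * f u + box 0 y (e - u) * f (e - u))) =
  2 * \int[mu]_u (box 0 e u * (box 0 y u * f u)).
Proof.
have i2 : mu.-integrable [set: R] (EFin \o (fun u => box 0 e u * (box 0 y (e - u) * f (e - u)))).
  apply: (@integrable_box _ _ _ (fun u => box 0 y (e - u) * f (e - u)) (2 * G (2 * V L))) => [|u _ _].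
    by apply: (measurableT_comp (measurable_boxf y)); exact: measurable_funB.
  exact: boxf_bound.
under eq_Rintegral do rewrite mulrDr.
rewrite (RintegralD measurableT (integrable_boxf y) i2).
rewrite (@Rintegral_box_reflect R 0 e e (fun u => box 0 y u * f u))// subr0 subrr.
by rewrite mulr_natl mulr2n.
Qed.

Lemma Rintegral_theta_ge0 (y : R) : y + e <= L ->
  0 <= \int[mu]_u (box 0 y u * H u).
Proof.
have e0' := e0; have e2L' := e2L.
move=> yL; apply: le_trans (Rintegral_boxH_ge yL).
rewrite -(@pmulr_rge0 _ 2)// -Rintegral_boxf_sym; apply: Rintegral_ge0 => u _.
rewrite boxE; case: (leP 0 u) => u0 /=; last by rewrite mul0r.
case: (leP u e) => ue; last by rewrite mul0r.
rewrite mul1r !boxE u0 (_ : 0 <= e - u) ?subr_ge0//=.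
have sym := f_spread_ge0 u0 ue.
(* If just one point of the pair is below y, it is the smaller one, hence in the first half. *)
case: (leP u y) => uy; case: (leP (e - u) y) => euy; rewrite ?mul1r ?mul0r ?addr0 ?add0r //.
  by apply: f_ge0 => //; lra.
by apply: f_ge0; lra.
Qed.

(* [gap e] is the value at [u = e / 4] of the diagonal excess [dd], which is
   decreasing. *)
Definition gap (r : R) : R := 2^-1 * (V (3 / 4 * r) - V (4^-1 * r)).

Lemma Rintegral_theta_ge (y : R) : e <= y -> y + e <= L ->
  3 / 8 * cubic_cst R m * s ^+ (m - 3) * gap e ^+ 3 * e <= \int[mu]_u (box 0 y u * H u).
Proof.
have e0' := e0; have e2L' := e2L.
move=> ey yL; apply: le_trans (Rintegral_boxH_ge yL).
pose k := 3 * cubic_cst R m * s ^+ (m - 3) * gap e ^+ 3.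
have gap0 : 0 <= gap e by rewrite mulr_ge0// subr_ge0; apply: V_homo; lra.
have k0 : 0 <= k by apply: mulr_ge0 => //; exact: exprn_ge0.
(* The 3/8 is the 3 of the spreading inequality, times 1/4 for the length of [0, e/4], where [dd] is
   at least [gap e], times 1/2 for the symmetrisation. *)
have -> : 3 / 8 * cubic_cst R m * s ^+ (m - 3) * gap e ^+ 3 * e = 2^-1 * (k * (4^-1 * e)).
  by rewrite /k; field.
rewrite ler_pdivrMl// -Rintegral_boxf_sym.
have <- : \int[mu]_u (box 0 (4^-1 * e) u * k) = k * (4^-1 * e).
  have ib : mu.-integrable [set: R] (EFin \o box 0 (4^-1 * e)).
    exact: (integrable_indic_itv 0 (4^-1 * e) true false).
  rewrite (RintegralZr _ measurableT ib) Rintegral_box1 ?subr0 1?mulrC//; lra.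
have pw (u : R) : box 0 (4^-1 * e) u * k <=
    box 0 e u * (box 0 y u * f u + box 0 y (e - u) * f (e - u)).
  rewrite !boxE.
  case: (leP 0 u) => u0 /=; last by rewrite !mul0r.
  case: (leP u e) => ue; last first.
    have -> : (u <= 4^-1 * e) = false by apply/negbTE; rewrite -ltNge; lra.
    by rewrite !mul0r.
  have h1 : u <= y by lra.
  have h2 : 0 <= e - u by lra.
  have h3 : e - u <= y by lra.
  rewrite h1 h2 h3 !mul1r.
  case: (leP u (4^-1 * e)) => ue4; last by rewrite mul0r; exact: f_spread_ge0.
  have u2 : u <= e - u by lra.
  rewrite mul1r; apply: le_trans (f_spread u0 u2).
  rewrite /k ler_wpM2l//.
  apply: lerXn2r; rewrite ?nnegrE//.
    by rewrite mulr_ge0// subr_ge0; exact: V_homo.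
  rewrite ler_wpM2l// lerB//; apply: V_homo; lra.
apply: le_Rintegral => //.
- by apply: (@integrable_box _ _ _ (fun=> k) `|k|).
- have i2 : mu.-integrable [set: R] (EFin \o (fun u => box 0 e u * (box 0 y (e - u) * f (e - u)))).
    apply: (@integrable_box _ _ _ (fun u => box 0 y (e - u) * f (e - u)) (2 * G (2 * V L))) => [|u _ _].
      by apply: (measurableT_comp (measurable_boxf y)); exact: measurable_funB.
    exact: boxf_bound.
  apply: eq_integrable (integrableD measurableT (integrable_boxf y) i2) => //.
  by move=> u _; exact: (esym (congr1 EFin (mulrDr _ _ _))).
Qed.

(** Beyond e, |theta| equals the telescoping bracket; before e, |theta| + w <= s + s/2, whence the
    factor 3/2. The bracket has a nonpositive integral. *)
Let theta_ub (y u : R) : y + e <= L ->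
  box 0 y u * `|theta e u| <=
  box 0 e u * (3 / 2 * s) + (box e y u * w (u - e) - box 0 y u * w u).
Proof.
have e0' := e0; have e2L' := e2L.
move=> yL; rewrite !boxE.
have [u0|u0] := ltP u 0; first by rewrite (lt_geF (lt_trans u0 e0)) !mul0r; lra.
have [uy|uy] := leP u y; last first.
  by rewrite !andbF !mul0r subrr addr0 mulr_ge0// mulr_ge0.
have w0 := w_ge0 (u - e); have w1 := w_ge0 u.
have uL : u + e <= L by lra.
have [ue|eu|ue] := ltgtP u e; rewrite /= ?mul1r ?mul0r.
- by have := theta_le u0 uL; have := w_le u0 uL; have := s_ge0 => *; lra.
- rewrite theta_far ?(ltW eu)// normrN ger0_norm ?add0r// subr_ge0.
  by apply: w_mono; lra.
- by have := theta_le u0 uL; have := w_le u0 uL; have := s_ge0 => *; lra.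
Qed.

Lemma norm_Rintegral_theta_le (y : R) : y + e <= L ->
  `|\int[mu]_u (box 0 y u * H u)| <= 3 / 2 * linear_cst R m * s ^+ m * e.
Proof.
have e0' := e0; have e2L' := e2L.
move=> yL; pose C := linear_cst R m * s ^+ m.-1.
have C0 : 0 <= C by rewrite mulr_ge0 ?exprn_ge0// linear_cst_ge0.
have wVL u : w u <= V L.
  have := V_le (u + e); have := V_ge0 u; have := V_ge0 (u + e) => *; rewrite /w; lra.
have wb u : 0 <= w u <= V L by rewrite w_ge0 wVL.
have h := @Rintegral_box_shift_le R w _ e y measurable_w wb (ltW e0).
have iw : mu.-integrable [set: R] (EFin \o (fun u => box 0 y u * w u)).
  by apply: (@integrable_box _ _ _ _ (V L)) => // u _ _; rewrite ger0_norm.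
have iwe : mu.-integrable [set: R] (EFin \o (fun u => box e y u * w (u - e))).
  apply: (@integrable_box _ _ _ (fun u => w (u - e)) (V L)) => [|u _ _].
    by apply: (measurableT_comp measurable_w); exact: measurable_funB.
  by rewrite ger0_norm.
have ib : mu.-integrable [set: R] (EFin \o (fun u => box 0 e u * (3 / 2 * s))).
  exact: (@integrable_box _ _ _ (fun=> 3 / 2 * s) `|3 / 2 * s|).
have iww : mu.-integrable [set: R] (EFin \o (fun u => box e y u * w (u - e) - box 0 y u * w u)).
  by apply: eq_integrable (integrableB measurableT iwe iw).
pose F u := box 0 e u * (3 / 2 * s) + (box e y u * w (u - e) - box 0 y u * w u).
have iF : mu.-integrable [set: R] (EFin \o F).
  by apply: eq_integrable (integrableD measurableT ib iww).
have FE : \int[mu]_u F u <= 3 / 2 * s * e.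
  rewrite (RintegralD measurableT ib iww) (RintegralB measurableT iwe iw).
  have ib1 : mu.-integrable [set: R] (EFin \o box 0 e).
    exact: (integrable_indic_itv 0 e true false).
  rewrite (RintegralZr _ measurableT ib1) Rintegral_box1 ?(ltW e0)// subr0.
  by rewrite [e * _]mulrC gerDl subr_le0.
apply: le_trans (le_normr_Rintegral measurableT (integrable_boxH y)) _.
have -> : 3 / 2 * linear_cst R m * s ^+ m * e = C * (3 / 2 * s * e).
  rewrite /C -[in s ^+ m](prednK (ltnW m_gt1)) exprSr; ring.
apply: (@le_trans _ _ (C * \int[mu]_u F u)); last by rewrite ler_wpM2l.
rewrite -(RintegralZl _ measurableT iF); apply: le_Rintegral => //.
- exact: integrable_norm (integrable_boxH y).
- by apply: eq_integrable (integrableZl measurableT C iF).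
move=> u _; apply: (@le_trans _ _ (C * (box 0 y u * `|theta e u|))); last first.
  by rewrite ler_wpM2l//; exact: theta_ub.
rewrite boxE; case: (leP 0 u) => u0 /=; last by rewrite !mul0r normr0 mulr0.
case: (leP u y) => uy; last by rewrite !mul0r normr0 mulr0.
by rewrite !mul1r; apply: norm_cross_moment_le => //; apply: theta_le => //; lra.
Qed.

Lemma Rintegral_theta_split (T t : R) : 0 <= t -> t <= T ->
  \int[mu]_(u in `[0, T]) H (u - t) =
  \int[mu]_u (box 0 (T - t) u * H u) + \int[mu]_u (box 0 t u * H u).
Proof.
move=> t0 tT; rewrite Rintegral_box Rintegral_box_shift// sub0r.
have HN u : H (0 - u) = H u by rewrite sub0r /H thetaN.
have <- : \int[mu]_u (box (- t) 0 u * H u) = \int[mu]_u (box 0 t u * H u).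
  have := @Rintegral_box_reflect R 0 t 0 _ measurable_H.
  by rewrite sub0r subr0 => <-; apply: eq_Rintegral => u _; rewrite HN.
have iH a b : mu.-integrable [set: R] (EFin \o (fun u => box a b u * H u)).
  by apply: (@integrable_box _ _ _ _ (G (2 * V L))) => // u _ _.
(* The boxes [0, T - t] and [-t, 0] share the point 0, which is null but counted twice in the
   pointwise identity. *)
have z : \int[mu]_u (box 0 0 u * H u) = 0.
  by rewrite -Rintegral_box set_itv1 Rintegral_set1.
have iHH : mu.-integrable [set: R] (EFin \o (fun u => box 0 (T - t) u * H u + box (- t) 0 u * H u)).
  by apply: eq_integrable (integrableD measurableT (iH 0 (T - t)) (iH (- t) 0)).
rewrite -(RintegralD measurableT (iH 0 (T - t)) (iH (- t) 0)).
transitivity (\int[mu]_u ((box 0 (T - t) u * H u + box (- t) 0 u * H u) - box 0 0 u * H u)); last first.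
  by rewrite (RintegralB measurableT iHH (iH 0 0)) z subr0.
apply: eq_Rintegral => u _; rewrite -mulrDl -mulrBl; congr (_ * _).
rewrite !boxE; case: (ltgtP u 0) => u0 /=; rewrite ?andbT ?andbF.
- rewrite (_ : u <= T - t) ?andbT; last by lra.
  by rewrite add0r subr0.
- by rewrite (_ : - t <= u) /= ?addr0 ?subr0//; lra.
- have h1 : u <= T - t by rewrite u0 subr_ge0.
  have h2 : - t <= u by rewrite u0 oppr_le0.
  by rewrite h1 h2 addrK.
Qed.

End kernel_integral.

(** * Second moment of a time integral *)

Section second_moment.
Context d1 d2 (T1 : measurableType d1) (T2 : measurableType d2) (R : realType).
Variables (m1 : {sigma_finite_measure set T1 -> \bar R}) (P : probability T2 R).
Variables (D : set T1) (mD : measurable D) (D_fin : (m1 D < +oo)%E)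
  (D_pos : (0 < m1 D)%E).
Variables (f : T1 * T2 -> R) (mf : measurable_fun [set: T1 * T2] f)
  (f_out : forall s w, ~ D s -> f (s, w) = 0).
Variables (C : R) (f_C : forall s, (\int[P]_w (f (s, w) ^+ 2)%:E <= C%:E)%E).

Let kap : R := fine (m1 D).
Let kapE : (kap%:E = m1 D)%E.
Proof. by rewrite /kap fineK// ge0_fin_numE. Qed.
Let kap_gt0 : 0 < kap.
Proof. by rewrite -lte_fin kapE. Qed.

Let ind1 s : D s -> \1_D s = 1 :> R.
Proof. by move=> sD; rewrite indicE mem_set. Qed.

Let ind0 s : ~ D s -> \1_D s = 0 :> R.
Proof. by move=> sD; rewrite indicE memNset. Qed.

(** Provides the dominating functions below: with [g] equal to 1, [V] or a section of [f], it bounds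
    [f] or its products through ab <= a^2 + b^2. *)
Let integrable_ind (g : T2 -> R) : measurable_fun [set: T2] g ->
  (\int[P]_w (g w ^+ 2)%:E < +oo)%E ->
  (m1 \x P)%E.-integrable [set: T1 * T2] (fun p => (\1_D p.1 * g p.2 ^+ 2)%:E).
Proof.
move=> mg gy.
have m : measurable_fun [set: T1 * T2] (fun p => (\1_D p.1 * g p.2 ^+ 2)%:E : \bar R).
  apply/measurable_EFinP; apply: measurable_funM.
    exact: (measurableT_comp (measurable_indic _)).
  by apply: measurable_funX; exact: (measurableT_comp mg).
apply/(integrable12ltyP _ _ m).
rewrite (eq_integral (fun s => (\1_D s)%:E * \int[P]_w (g w ^+ 2)%:E)%E); last first.
  move=> s _; rewrite -ge0_integralZl//=; last 2 first.
  - by apply/measurable_EFinP; exact: measurable_funX.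
  - by move=> w _; rewrite lee_fin sqr_ge0.
  by apply: eq_integral => w _; rewrite /= ger0_norm ?EFinM// mulr_ge0 ?sqr_ge0.
rewrite ge0_integralZr//=; last 2 first.
- by apply/measurable_EFinP; exact: measurable_indic.
- by apply: integral_ge0 => w _; rewrite lee_fin sqr_ge0.
rewrite integral_indic// setIT lte_mul_pinfty// ge0_fin_numE//.
Qed.

Let integrable_f2 : (m1 \x P)%E.-integrable [set: T1 * T2] (fun p => (f p ^+ 2)%:E).
Proof.
have m : measurable_fun [set: T1 * T2] (fun p => (f p ^+ 2)%:E : \bar R).
  by apply/measurable_EFinP; exact: measurable_funX.
apply/(integrable12ltyP _ _ m).
apply: (@le_lt_trans _ _ (\int[m1]_s (C%:E * (\1_D s)%:E))%E).
  apply: ge0_le_integral => //.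
  - by move=> s _; exact: integral_ge0.
  - apply: (measurable_fun_fubini_tonelli_F (abse \o (fun p => (f p ^+ 2)%:E))) => //=.
    exact: measurableT_comp.
  - apply: emeasurable_funM => //; apply/measurable_EFinP; exact: measurable_indic.
  - move=> s _; under eq_integral do rewrite gee0_abs ?lee_fin ?sqr_ge0//.
    have [sD|sD] := pselect (D s).
      by rewrite indicE mem_set// mule1.
    under eq_integral do rewrite f_out// expr0n.
    by rewrite integral0 indicE memNset// mule0.
have C0 : (0 <= C%:E)%E.
  have [s _] : exists s : T1, True by exists point.
  by apply: le_trans (f_C s); apply: integral_ge0 => w _; rewrite lee_fin sqr_ge0.
rewrite ge0_integralZl//=; last by apply/measurable_EFinP; exact: measurable_indic.
by rewrite integral_indic// setIT lte_mul_pinfty.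
Qed.

(** Dominated by [f ^+ 2 + 1] on the time set [D], which has finite measure. *)
Lemma integrable_bounded_second_moment : (m1 \x P)%E.-integrable [set: T1 * T2] (EFin \o f).
Proof.
have i1 : (m1 \x P)%E.-integrable [set: T1 * T2] (fun p => (\1_D p.1 * (cst 1 p.2) ^+ 2)%:E).
  apply: (integrable_ind (g := cst 1)) => //.
  under eq_integral do rewrite /= expr1n.
  by rewrite integral_cst//= mul1e probability_setT ltry.
have := integrableD measurableT integrable_f2 i1.
apply: le_integrable => //; first exact/measurable_EFinP.
move=> [s w] _; rewrite /= lee_fin expr1n mulr1.
have [sD|sD] := pselect (D s); last first.
  by rewrite f_out// normr0.
rewrite ind1// [leRHS]ger0_norm ?addr_ge0 ?sqr_ge0//.
rewrite -[_ ^+ 2]real_normK ?num_real//.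
have := sqr_ge0 (`|f (s, w)| - 1); have := normr_ge0 (f (s, w)).
move: `|f (s, w)| => x; nra.
Qed.

Let V (w : T2) : R := \int[m1]_s f (s, w).

Let measurable_V : measurable_fun [set: T2] V.
Proof.
apply: (measurableT_comp (fine_measurable _)) => //.
exact: (measurable_fubini_G integrable_bounded_second_moment).
Qed.

(** Cauchy-Schwarz on [D], from the nonnegative integral of (f - c)^2 over [D] with [c] the mean of
    [f] there. *)
Let V2_le w : m1.-integrable [set: T1] (fun s => (f (s, w))%:E) ->
  m1.-integrable [set: T1] (fun s => (f (s, w) ^+ 2)%:E) ->
  V w ^+ 2 <= kap * \int[m1]_s (f (s, w) ^+ 2).
Proof.
move=> i1 i2.
pose c := V w / kap.
have iD : m1.-integrable [set: T1] (fun s => (\1_D s)%:E).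
  apply/integrableP; split; first by apply/measurable_EFinP; exact: measurable_indic.
  under eq_integral do rewrite gee0_abs ?lee_fin//.
  by rewrite integral_indic// setIT.
have iD1 : m1.-integrable [set: T1] (EFin \o (fun s => c ^+ 2 * \1_D s)).
  by apply: eq_integrable (integrableZl measurableT (c ^+ 2) iD).
have if1 : m1.-integrable [set: T1] (EFin \o (fun s => (2 * c) * f (s, w))).
  by apply: eq_integrable (integrableZl measurableT (2 * c) i1).
have if2 : m1.-integrable [set: T1] (EFin \o (fun s => f (s, w) ^+ 2 - (2 * c) * f (s, w))).
  by apply: eq_integrable (integrableB measurableT i2 if1).
have : 0 <= \int[m1]_s ((f (s, w) ^+ 2 - (2 * c) * f (s, w)) + c ^+ 2 * \1_D s).
  apply: Rintegral_ge0 => s _.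
  have [sD|sD] := pselect (D s); last first.
    by rewrite ind0// f_out// expr0n !mulr0 subr0 addr0.
  by rewrite ind1//; have := sqr_ge0 (f (s, w) - c); nra.
rewrite (RintegralD measurableT if2 iD1) (RintegralB measurableT i2 if1).
rewrite (RintegralZl _ measurableT i1) (RintegralZl _ measurableT iD) -/(V w).
have -> : \int[m1]_s \1_D s = kap.
  by rewrite /Rintegral integral_indic// setIT.
move: (\int[m1]_s _) => I2; rewrite /c => h.
have {h} : 0 <= kap * (I2 - 2 * (V w / kap) * V w + (V w / kap) ^+ 2 * kap).
  by rewrite mulr_ge0// ltW.
have -> : kap * (I2 - 2 * (V w / kap) * V w + (V w / kap) ^+ 2 * kap) = kap * I2 - V w ^+ 2.
  by field; rewrite gt_eqF.
by rewrite subr_ge0.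
Qed.

Let V2_lty : (\int[P]_w (V w ^+ 2)%:E < +oo)%E.
Proof.
have i2 := ae_integrable2 integrable_f2; have i1 := ae_integrable2 integrable_bounded_second_moment.
apply: (@le_lt_trans _ _ (\int[P]_w (kap%:E * \int[m1]_s (f (s, w) ^+ 2)%:E))%E).
  apply: ae_ge0_le_integral => //.
  - by move=> w _; rewrite lee_fin sqr_ge0.
  - by apply/measurable_EFinP; exact: (measurable_funX 2 measurable_V).
  - move=> w _; apply: mule_ge0; first by rewrite lee_fin ltW.
    by apply: integral_ge0 => s _; rewrite lee_fin sqr_ge0.
  - apply: emeasurable_funM => //.
    exact: (measurable_fubini_G integrable_f2).
  - apply: filterS2 i1 i2 => w i1 i2 _.
    have := V2_le i1 i2; rewrite -lee_fin => /le_trans; apply.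
    have fn : (\int[m1]_s (f (s, w) ^+ 2)%:E)%E \is a fin_num.
      exact: (integrable_fin_num measurableT i2).
    by rewrite EFinM -[X in (_ <= _ * X)%E](fineK fn).
rewrite ge0_integralZl//=; last 3 first.
- exact: (measurable_fubini_G integrable_f2).
- by move=> w _; apply: integral_ge0 => s _; rewrite lee_fin sqr_ge0.
- by rewrite lee_fin ltW.
rewrite lte_mul_pinfty ?lee_fin ?ltW//.
have m : measurable_fun [set: T1 * T2] (fun p => (f p ^+ 2)%:E : \bar R).
  exact: (measurable_int _ integrable_f2).
have := (integrable21ltyP _ _ m).1 integrable_f2.
apply: le_lt_trans; rewrite le_eqVlt; apply/orP; left; apply/eqP.
apply: eq_integral => w _; apply: eq_integral => s _.
by rewrite gee0_abs// lee_fin sqr_ge0.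
Qed.

Let integrable_fV : (m1 \x P)%E.-integrable [set: T1 * T2] (fun p => (f p * V p.2)%:E).
Proof.
have := integrableD measurableT integrable_f2 (integrable_ind measurable_V V2_lty).
apply: le_integrable => //.
  apply/measurable_EFinP; apply: measurable_funM => //.
  exact: (measurableT_comp measurable_V).
move=> [s w] _; rewrite /= lee_fin.
have [sD|sD] := pselect (D s); last by rewrite f_out// mul0r normr0.
rewrite ind1// mul1r [leRHS]ger0_norm ?addr_ge0 ?sqr_ge0//.
rewrite normrM -[_ ^+ 2]real_normK ?num_real// -[X in _ + X]real_normK ?num_real//.
have := sqr_ge0 (`|f (s, w)| - `|V w|).
have : 0 <= `|f (s, w)| * `|V w| by rewrite mulr_ge0.
move: `|f (s, w)| `|V w| => x y; nra.
Qed.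

Let measurable_fs s : measurable_fun [set: T2] (fun w => f (s, w)).
Proof. exact: (measurableT_comp mf). Qed.

Let fs_lty s : (\int[P]_w (f (s, w) ^+ 2)%:E < +oo)%E.
Proof. exact: le_lt_trans (f_C s) (ltry _). Qed.

Let integrable_fsf s : (m1 \x P)%E.-integrable [set: T1 * T2]
  (fun p => (f (s, p.2) * f p)%:E).
Proof.
have := integrableD measurableT integrable_f2 (integrable_ind (measurable_fs s) (fs_lty s)).
apply: le_integrable => //.
  apply/measurable_EFinP; apply: measurable_funM => //.
  exact: (measurableT_comp (measurable_fs s)).
move=> [t w] _; rewrite /= lee_fin.
have [tD|tD] := pselect (D t); last first.
  by rewrite (@f_out t)// mulr0 normr0.
rewrite ind1// mul1r [leRHS]ger0_norm ?addr_ge0 ?sqr_ge0//.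
rewrite normrM -[_ ^+ 2]real_normK ?num_real// -[X in _ + X]real_normK ?num_real//.
have := sqr_ge0 (`|f (s, w)| - `|f (t, w)|).
have : 0 <= `|f (s, w)| * `|f (t, w)| by rewrite mulr_ge0.
move: `|f (s, w)| `|f (t, w)| => x y; nra.
Qed.

Let integral_fV s : (\int[P]_w (f (s, w) * V w)%:E =
  \int[m1]_t \int[P]_w (f (s, w) * f (t, w))%:E)%E.
Proof.
have i1 := ae_integrable2 integrable_bounded_second_moment.
rewrite (Fubini (integrable_fsf s)) /=; apply: ae_eq_integral => //.
- have /measurable_EFinP h := measurable_int _ integrable_fV.
  by apply/measurable_EFinP; exact: (measurableT_comp h (pair1_measurable s)).
- exact: (measurable_fubini_G (integrable_fsf s)).
apply: filterS i1 => w i1 _.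
under [RHS]eq_integral do rewrite EFinM.
rewrite integralZl// EFinM; congr (_ * _)%E.
by rewrite /V /Rintegral fineK//; exact: (integrable_fin_num measurableT i1).
Qed.

(** The factors of V^2 are expanded one at a time: Fubini is applied to f V, which is integrable
    since V is square integrable, and then to [f] multiplied by a fixed section of itself. *)
Lemma second_moment_Fubini :
  [/\ measurable_fun [set: T2] V, (\int[P]_w (V w ^+ 2)%:E < +oo)%E,
      measurable_fun [set: T1]
        (fun s => \int[m1]_t \int[P]_w (f (s, w) * f (t, w))%:E)%E &
  (\int[P]_w (V w ^+ 2)%:E =
   \int[m1]_s \int[m1]_t \int[P]_w (f (s, w) * f (t, w))%:E)%E].
Proof.
split; [exact: measurable_V|exact: V2_lty| |].
  rewrite (_ : (fun s => _) = fun s => (\int[P]_w (f (s, w) * V w)%:E)%E).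
    exact: (measurable_fubini_F integrable_fV).
  by apply/funext => s; rewrite -integral_fV.
have i1 := ae_integrable2 integrable_bounded_second_moment.
transitivity (\int[P]_w \int[m1]_s (f (s, w) * V w)%:E)%E.
  apply: ae_eq_integral => //.
  - by apply/measurable_EFinP; exact: (measurable_funX 2 measurable_V).
  - exact: (measurable_fubini_G integrable_fV).
  apply: filterS i1 => w i1 _.
  under eq_integral do rewrite mulrC EFinM.
  rewrite integralZl// expr2 EFinM; congr (_ * _)%E.
  by rewrite /V /Rintegral fineK//; exact: (integrable_fin_num measurableT i1).
rewrite -(Fubini integrable_fV) /=.
by apply: eq_integral => s _; exact: integral_fV.
Qed.

End second_moment.

(** * Increments of measurable processes *)

Section translation.
Context {R : realType}.
Local Notation mu := (@lebesgue_measure R).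

Lemma box_le (a b x y u : R) : x <= a -> b <= y -> box a b u <= box x y u.
Proof.
move=> xa yb; rewrite !boxE; case: (leP a u) => au //=.
case: (leP u b) => ub //=.
by rewrite (le_trans xa au) (le_trans ub yb).
Qed.

Lemma ge0_cvge0 I (F : set_system I) {FF : Filter F} (u : I -> \bar R) :
  (forall n, 0 <= u n)%E ->
  (forall eps : R, 0 < eps -> \forall n \near F, (u n <= eps%:E)%E) ->
  u @ F --> 0%E.
Proof.
move=> u0 h; apply/fine_cvgP; split.
  apply: filterS (h 1 ltr01) => n un.
  by rewrite ge0_fin_numE// (le_lt_trans un) ?ltry.
apply/cvgr0Pnorm_le => eps eps0; apply: filterS (h eps eps0) => n un.
have fn : u n \is a fin_num by rewrite ge0_fin_numE// (le_lt_trans un) ?ltry.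
by rewrite /= ger0_norm ?fine_ge0// -lee_fin fineK.
Qed.

Lemma continuous_bounded_segment (c : R -> R) (a b : R) : continuous c -> a <= b ->
  exists M : R, forall s, a <= s -> s <= b -> `|c s| <= M.
Proof.
move=> cc ab.
have cn : {within `[a, b], continuous (fun s => `|c s|)}.
  by apply: continuous_subspaceT => s; apply: continuous_comp (cc s) _; exact: norm_continuous.
have [s0 _ h] := EVT_max ab cn.
by exists `|c s0| => s as_ sb; apply: h; rewrite in_itv/= as_ sb.
Qed.

(** Dominated convergence: [harmonic n <= 1] keeps all shifted points in [0, 2a], where [c] is
    bounded. *)
Lemma continuous_translation_cvg (c : R -> R) (a : R) : continuous c -> 0 < a ->
  (\int[mu]_s (box 0 a s * `|c (s + a * harmonic n) - c s|)%:E)%E @[n --> \oo] --> 0%E.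
Proof.
move=> cc a0.
have [M cM] := @continuous_bounded_segment c 0 (2 * a) cc ltac:(lra).
have mc : measurable_fun [set: R] c by exact: continuous_measurable_fun.
have mf n : measurable_fun [set: R]
    (fun s => (box 0 a s * `|c (s + a * harmonic n) - c s|)%:E : \bar R).
  apply/measurable_EFinP; apply: measurable_funM; first exact: measurable_box.
  apply: measurableT_comp => //; apply: measurable_funB => //.
  by apply: (measurableT_comp mc); exact: measurable_funD.
have har n : 0 <= (harmonic n : R) <= 1.
  by rewrite /= invr_ge0 ler0n /= invf_le1 ?ler1n// ltr0n.
have ib : mu.-integrable [set: R] (EFin \o (fun s => box 0 a s * (2 * M))).
  exact: (@integrable_box _ _ _ (fun=> 2 * M) `|2 * M|).
have lim (s : R) : (box 0 a s * `|c (s + a * harmonic n) - c s|) @[n --> \oo] --> (0 : R).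
  have hs : (s + a * harmonic n) @[n --> \oo] --> s.
    rewrite -[X in _ --> X]addr0; apply: cvgD; first exact: cvg_cst.
    rewrite -[X in _ --> X](mulr0 a); apply: cvgM; first exact: cvg_cst.
    exact: cvg_harmonic.
  have cs : c (s + a * harmonic n) @[n --> \oo] --> c s by exact: (cvg_comp _ _ hs (cc s)).
  rewrite -[X in _ --> X](mulr0 (box 0 a s)); apply: cvgM; first exact: cvg_cst.
  rewrite -[X in _ --> X](normr0 R); apply: cvg_norm.
  by rewrite -[X in _ --> X](subrr (c s)); apply: cvgB => //; exact: cvg_cst.
have bnd (s : R) n : (`|(box 0 a s * `|c (s + a * harmonic n) - c s|)%:E| <=
    (box 0 a s * (2 * M))%:E)%E.
  rewrite lee_fin ger0_norm; last by rewrite mulr_ge0// boxE.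
  rewrite boxE; case: (leP 0 s) => s0 /=; last by rewrite !mul0r.
  case: (leP s a) => sa; last by rewrite !mul0r.
  have /andP[h0 h1] := har n.
  have ah : a * harmonic n <= a by rewrite ler_piMr// ltW.
  have ah0 : 0 <= a * harmonic n by rewrite mulr_ge0// ltW.
  rewrite !mul1r (le_trans (ler_normB _ _))// mulr_natl mulr2n lerD//; apply: cM => //.
  - by rewrite addr_ge0.
  - by apply: le_trans (lerD sa ah) _; lra.
  - by apply: le_trans sa _; lra.
rewrite [X in _ --> X](_ : 0%E = \int[mu]_(s in [set: R]) (cst 0%E s))%E; last by rewrite integral0.
have [] // := @dominated_convergence _ _ _ mu setT measurableT _ (cst 0%E) _ mf _ _ ib.
- by apply: aeW => s _; apply: cvg_EFin (lim s); apply: nearW.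
- by apply: aeW => s n _; exact: bnd.
Qed.

(** Three thirds of [eps]: [g] is replaced by a continuous function close to it in L1 of [0, 2a], an
    interval that contains [0, a] together with its translates. *)
Lemma translation_cvg (g : R -> R) (a : R) :
  mu.-integrable [set: R] (EFin \o g) -> 0 < a ->
  (\int[mu]_s (box 0 a s * `|g (s + a * harmonic n) - g s|)%:E)%E @[n --> \oo] --> 0%E.
Proof.
move=> ig a0; apply: ge0_cvge0 => [n|eps eps0].
  by apply: integral_ge0 => s _; rewrite lee_fin mulr_ge0// boxE.
have mg : measurable_fun [set: R] g by apply/measurable_EFinP; exact: (measurable_int mu).
have mE : measurable (`[0, 2 * a]%classic : set R) by [].
have Efin : (mu `[0%R, (2 * a)%R]%classic < +oo)%E.
  by rewrite lebesgue_measure_itv/=; case: ifP => _; rewrite ?ltry// -EFinB ltry.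
have igE : mu.-integrable `[0, 2 * a] (EFin \o g) by exact: integrableS ig.
have [g_ [gc gi gcvg]] := approximation_continuous_integrable mE Efin igE.
have e3 : 0 < eps / 3 by rewrite divr_gt0.
have /fine_cvgP[fin lim] := gcvg.
have /cvgr0Pnorm_le /(_ _ e3) lime := lim.
have [k [fink limk]] : exists k,
   (\int[mu]_(z in `[0%R, (2 * a)%R]) `|(g z - g_ k z)%:E|)%E \is a fin_num /\
   `|(fine \o (fun n => \int[mu]_(z in `[0%R, (2 * a)%R]) `|(g z - g_ n z)%:E|)%E) k| <= eps / 3.
  by have [k [h1 h2]] := filter_ex (filterI fin lime); exists k.
set c := g_ k in fink limk; have cc : continuous c by exact: gc.
have mc : measurable_fun [set: R] c by exact: continuous_measurable_fun.
pose q s := `|g s - c s|.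
have mq : measurable_fun [set: R] q.
  by apply: measurableT_comp => //; exact: measurable_funB.
have Iq : (\int[mu]_s (box 0 (2 * a) s * q s)%:E <= (eps / 3)%:E)%E.
  move: limk; rewrite /= ger0_norm; last by rewrite fine_ge0// integral_ge0.
  rewrite -lee_fin fineK//; apply: le_trans.
  rewrite [X in (_ <= X)%E]integral_mkcond le_eqVlt; apply/orP; left; apply/eqP.
  apply: eq_integral => s _.
  rewrite patchE /box indicE; case: ifP => _; rewrite ?mul0r//.
  by rewrite mul1r.
have /fine_cvgP[finc limc] := continuous_translation_cvg cc a0.
have /cvgr0Pnorm_le /(_ _ e3) limce := limc.
apply: filterS2 finc limce => n fn; rewrite /= ger0_norm; last first.
  by rewrite fine_ge0// integral_ge0// => s _; rewrite lee_fin mulr_ge0// boxE.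
rewrite -lee_fin fineK// => Ic.
pose h := a * harmonic n.
have h0 : 0 <= h by rewrite mulr_ge0 ?(ltW a0)//= invr_ge0.
have ha : h <= a by rewrite ler_piMr ?(ltW a0)//= invf_le1 ?ler1n// ltr0n.
have b0 x y s : 0 <= box x y s :> R by rewrite boxE.
have mb x y : measurable_fun [set: R] (@box R x y) by exact: measurable_box.
have msh (p : R -> R) : measurable_fun [set: R] p -> measurable_fun [set: R] (fun s => p (s + h)).
  by move=> mp; apply: (measurableT_comp mp); exact: measurable_funD.
have m1 : measurable_fun [set: R] (fun s => (box 0 a s * q (s + h))%:E : \bar R).
  by apply/measurable_EFinP; apply: measurable_funM => //; exact: msh.
have m2 : measurable_fun [set: R] (fun s => (box 0 a s * `|c (s + h) - c s|)%:E : \bar R).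
  apply/measurable_EFinP; apply: measurable_funM => //; apply: measurableT_comp => //.
  by apply: measurable_funB => //; exact: msh.
have m3 : measurable_fun [set: R] (fun s => (box 0 a s * q s)%:E : \bar R).
  by apply/measurable_EFinP; exact: measurable_funM.
have q0 s : 0 <= q s by rewrite /q.
have mbq x y : measurable_fun [set: R] (fun s => (box x y s * q s)%:E : \bar R).
  by apply/measurable_EFinP; exact: measurable_funM.
have I1 : (\int[mu]_s (box 0 a s * q (s + h))%:E <= (eps / 3)%:E)%E.
  apply: le_trans Iq.
  have mF : measurable_fun [set: R] (fun u => (box h (a + h) u * q u)%:E : \bar R).
    exact: mbq.
  have := @ge0_integral_affine R 1 h _ (oner_neq0 _) mF
     (fun u => ltac:(by rewrite lee_fin mulr_ge0)).
  rewrite normr1 invr1 mul1e => E.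
  rewrite (_ : (\int[mu]_s (box 0 a s * q (s + h))%:E = \int[mu]_u (box h (a + h) u * q u)%:E)%E).
    apply: ge0_le_integral => //.
    - by move=> u _; rewrite lee_fin mulr_ge0.
    - exact: mbq.
    - by move=> u _; rewrite lee_fin ler_wpM2r// box_le//; lra.
  rewrite -E; apply: eq_integral => s _; rewrite mul1r; congr ((_ * _)%:E).
  by rewrite !boxE lerD2r lerDr.
have I3 : (\int[mu]_s (box 0 a s * q s)%:E <= (eps / 3)%:E)%E.
  apply: le_trans Iq; apply: ge0_le_integral => //.
  - by move=> u _; rewrite lee_fin mulr_ge0.
  - exact: mbq.
  - by move=> u _; rewrite lee_fin ler_wpM2r// box_le//; lra.
have -> : eps%:E = ((eps / 3)%:E + (eps / 3)%:E + (eps / 3)%:E)%E.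
  by rewrite -!EFinD; congr (_%:E); field.
apply: le_trans (leeD (leeD I1 Ic) I3).
rewrite -ge0_integralD//=; last 2 first.
- by move=> s _; rewrite lee_fin mulr_ge0.
- by move=> s _; rewrite lee_fin mulr_ge0.
rewrite -ge0_integralD//=; last 3 first.
- by move=> s _; rewrite -EFinD lee_fin addr_ge0// mulr_ge0.
- exact: emeasurable_funD.
- by move=> s _; rewrite lee_fin mulr_ge0.
apply: ge0_le_integral => //.
- by move=> s _; rewrite lee_fin mulr_ge0.
- apply/measurable_EFinP; apply: measurable_funM => //; apply: measurableT_comp => //.
  by apply: measurable_funB => //; exact: msh.
- by apply: emeasurable_funD => //; exact: emeasurable_funD.
move=> s _; rewrite -!EFinD lee_fin -!mulrDr ler_wpM2l// /q.
have -> : g (s + h) - g s = (g (s + h) - c (s + h)) + (c (s + h) - c s) - (g s - c s) by ring.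
by rewrite (le_trans (ler_normB _ _))// lerD2r ler_normD.
Qed.

End translation.

Section joint_translation.
Context d (Omega : measurableType d) (R : realType) (P : probability Omega R).
Local Notation mu := (@lebesgue_measure R).

(* Paths being integrable, translation is L1-continuous along almost every
   path; dominated convergence transfers this to the mean. *)
Lemma measurable_process_no_gap (f : R * Omega -> R) (L c : R) :
  (mu \x P)%E.-integrable [set: R * Omega] (EFin \o f) -> 0 < L -> 0 < c ->
  (forall s h : R, 0 <= s -> 0 < h -> s + h <= L ->
     (c%:E <= \int[P]_w `|f (s + h, w) - f (s, w)|%:E)%E) -> False.
Proof.
move=> intf L0 c0 gap; pose a := L / 2; have a0 : 0 < a by rewrite divr_gt0.
have mf : measurable_fun [set: R * Omega] f.
  by apply/measurable_EFinP; exact: (measurable_int _ intf).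
pose h n : R := a * harmonic n.
have h0 n : 0 < h n by rewrite mulr_gt0// harmonic_gt0.
have ha n : h n <= a by rewrite ler_piMr ?(ltW a0)//= invf_le1 ?ler1n// ltr0n.
have b0 x y s : 0 <= box x y s :> R by rewrite boxE.
pose q n (p : R * Omega) : \bar R := (box 0 a p.1 * `|f (p.1 + h n, p.2) - f p|)%:E.
have q0 n p : (0 <= q n p)%E by rewrite lee_fin mulr_ge0.
have mq n : measurable_fun [set: R * Omega] (q n).
  apply/measurable_EFinP; apply: measurable_funM.
    exact: (measurableT_comp (measurable_box 0 a)).
  apply: measurableT_comp => //; apply: measurable_funB => //.
  apply: (measurableT_comp mf); apply/measurable_fun_pairP; split => /=.
    by apply: measurable_funD.
  exact: measurable_snd.
pose U n w : \bar R := (\int[mu]_s q n (s, w))%E.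
have mU n : measurable_fun [set: Omega] (U n).
  refine (measurable_fun_fubini_tonelli_G (m1 := mu) (q n) (mq n) (q0 n)).
pose G w : \bar R := (\int[mu]_s `|f (s, w)|%:E)%E.
have mabs : measurable_fun [set: R * Omega] (fun p => `|f p|%:E : \bar R).
  by apply/measurable_EFinP; exact: measurableT_comp.
have mG : measurable_fun [set: Omega] G.
  by apply: (measurable_fun_fubini_tonelli_G (m1 := mu) (fun p => `|f p|%:E)) => // p; rewrite lee_fin.
have G0 w : (0 <= G w)%E by apply: integral_ge0 => s _; rewrite lee_fin.
have iG : P.-integrable [set: Omega] (fun w => (2%:E * G w)%E).
  apply: integrableZl => //; apply/integrableP; split => //.
  have mEf := measurable_int _ intf.
  have := (integrable21ltyP _ _ mEf).1 intf.
  apply: le_lt_trans; rewrite le_eqVlt; apply/orP; left; apply/eqP.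
  by apply: eq_integral => w _; rewrite gee0_abs.
have UG n w : (U n w <= 2%:E * G w)%E.
  have mw : measurable_fun [set: R] (fun s => `|f (s, w)|%:E : \bar R).
    exact: (measurableT_comp mabs (pair2_measurable w)).
  have mwh : measurable_fun [set: R] (fun s => `|f (s + h n, w)|%:E : \bar R).
    by apply: (measurableT_comp mw); exact: measurable_funD.
  have := @ge0_integral_affine R 1 (h n) _ (oner_neq0 _) mw (fun u => ltac:(by rewrite lee_fin)).
  rewrite normr1 invr1 mul1e => E.
  have E1 : (\int[mu]_s `|f (s + h n, w)|%:E = G w)%E.
    by rewrite /G -E; apply: eq_integral => s _; rewrite mul1r.
  have -> : (2%:E * G w = \int[mu]_s (`|f (s + h n, w)|%:E + `|f (s, w)|%:E))%E.
    apply: esym; transitivity (\int[mu]_s `|f (s + h n, w)|%:E + \int[mu]_s `|f (s, w)|%:E)%E.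
      by apply: ge0_integralD => // s _; rewrite lee_fin.
    by rewrite E1 mule_natl mule2n.
  apply: ge0_le_integral => //.
  - exact: (measurableT_comp (mq n) (pair2_measurable w)).
  - exact: emeasurable_funD.
  - move=> s _; rewrite -EFinD lee_fin /=.
    apply: (@le_trans _ _ (1 * `|f (s + h n, w) - f (s, w)|)).
      by rewrite ler_wpM2r// boxE; case: (_ && _).
    by rewrite mul1r ler_normB.
have cvgU : {ae P, forall w, [set: Omega] w -> U ^~ w @ \oo --> (cst 0%E w)}.
  have := ae_integrable2 intf; apply: filterS => w iw _.
  exact: (translation_cvg iw a0).
have [] := @dominated_convergence _ _ _ P setT measurableT U (cst 0%E) _ mU
  (measurable_cst _) cvgU iG.
  by apply: aeW => w n _; rewrite gee0_abs// integral_ge0.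
move=> _ _; rewrite integral0 => lim.
suff : ((a * c)%:E <= 0)%E by rewrite lee_fin leNgt mulr_gt0.
apply: (cvge_ge _ lim); apply: nearW => n /=.
have -> : (\int[P]_w U n w = \int[mu]_s \int[P]_w q n (s, w))%E.
  exact: (esym (fubini_tonelli (m1 := mu) (m2 := P) (q n) (mq n) (q0 n))).
rewrite (_ : (a * c)%:E = \int[mu]_s (box 0 a s * c)%:E)%E.
  apply: ge0_le_integral => //.
  - by move=> s _; rewrite lee_fin mulr_ge0// ltW.
  - by apply/measurable_EFinP; apply: measurable_funM => //; exact: measurable_box.
  - exact: (measurable_fun_fubini_tonelli_F (q n)).
  move=> s _; rewrite /q /=.
  under eq_integral do rewrite EFinM.
  rewrite ge0_integralZl//=; last 2 first.
  - apply/measurable_EFinP; apply: measurableT_comp => //.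
    by apply: measurable_funB; exact: (measurableT_comp mf (pair1_measurable _)).
  - by rewrite lee_fin.
  rewrite EFinM boxE; case: (leP 0 s) => s0 /=; last by rewrite !mul0e.
  case: (leP s a) => sa; last by rewrite !mul0e.
  rewrite !mul1e; apply: gap => //.
  by apply: le_trans (lerD sa (ha n)) _; rewrite /a; lra.
have ib : mu.-integrable [set: R] (EFin \o box 0 a).
  exact: (integrable_indic_itv 0 a true false).
have := RintegralZr c measurableT ib; rewrite Rintegral_box1 ?subr0 ?(ltW a0)// => <-.
rewrite /Rintegral fineK//; apply: integrable_fin_num => //.
by apply: eq_integrable (integrableZr measurableT c ib).
Qed.

End joint_translation.

(** * Second moment of the odd variation *)

Section odd_variation.
Context (R : realType) (d : measure_display)
  (Omega : measurableType d) (P : probability Omega R).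
Local Notation mu := (@lebesgue_measure R).
Variables (m : nat) (T eps0 : R) (X : R -> Omega -> R) (delta : R -> R).
Hypotheses (m_gt1 : (1 < m)%N) (m_odd : odd m) (T_gt0 : 0 < T) (eps0_gt0 : 0 < eps0).
Let L := T + eps0.
Let D : set R := `[0, L]%classic.
Let v r := delta r ^+ 2.
Hypotheses (X_meas : jointly_measurable D X)
  (X_gauss : gaussian_process P D X)
  (X_centered : centered P D X)
  (X_incr : increments_variance P D X v)
  (delta2_incr : {in `[0, L] &, {homo v : r1 r2 / r1 <= r2}})
  (delta2_concave : concave_function D v).

Let L_gt0 : 0 < L. Proof. exact: addr_gt0. Qed.

Let DE (r : R) : 0 <= r -> r <= L -> D r.
Proof. by move=> r0 rL; rewrite /D /= in_itv/= r0 rL. Qed.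

Let clamp (r : R) := Num.max 0 (Num.min r L).

Let clamp_itv r : clamp r \in `[0, L].
Proof.
rewrite in_itv/= /clamp le_max lexx /= ge_max (ltW L_gt0) /=.
by rewrite ge_min lexx orbT.
Qed.

Let clampE (r : R) : 0 <= r -> r <= L -> clamp r = r.
Proof. by move=> r0 rL; rewrite /clamp (min_idPl rL) (max_idPr r0). Qed.

(* Nothing is known of [delta] outside [0, T + eps0]; clamping its argument
   makes the variance monotone on the whole line, hence measurable. *)
Definition clamped_variance (r : R) : R := v (clamp r).
Local Notation V := clamped_variance.

Lemma clamped_varianceE (r : R) : 0 <= r -> r <= L -> V r = v r.
Proof. by move=> r0 rL; rewrite /V clampE. Qed.

(** The increment from time 0 to time 0 vanishes identically. *)
Lemma clamped_variance0 : V 0 = 0.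
Proof.
have D0 : D 0 by apply: DE => //; exact: ltW.
rewrite clamped_varianceE//; last exact: ltW.
have := increment_second_moment X_incr D0 D0.
rewrite subr0 normr0 => <-; rewrite -[RHS](Rintegral_set0 P (fun=> 0)).
rewrite Rintegral_set0; under eq_Rintegral do rewrite subrr expr0n/=.
by rewrite Rintegral_cst// mul0r.
Qed.

Lemma clamped_variance_homo : {homo V : a b / a <= b}.
Proof.
move=> a b ab; apply: delta2_incr => //.
by rewrite /clamp; apply: le_max2 => //; exact: le_min2.
Qed.

Lemma clamped_variance_ge0 r : 0 <= V r. Proof. exact: sqr_ge0. Qed.

Lemma clamped_variance_le r : V r <= V L.
Proof.
apply: delta2_incr => //; rewrite (clampE (ltW L_gt0) (lexx L)).
by have := clamp_itv r; rewrite in_itv/= => /andP[].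
Qed.

Lemma variance_concave (x y t : R) : 0 <= x <= L -> 0 <= y <= L -> 0 <= t <= 1 ->
  t * v x + (1 - t) * v y <= v (t * x + (1 - t) * y).
Proof.
move=> xD yD /andP[t0 t1].
have xD' : x \in D by rewrite inE /D /= in_itv.
have yD' : y \in D by rewrite inE /D /= in_itv.
have h : - v (t * x + (1 - t) * y) <= t * (- v x) + (1 - t) * (- v y).
  exact: (delta2_concave (Itv01 t0 t1) xD' yD').
lra.
Qed.

(** The points b and a + h are convex combinations of a and b + h with exchanged weights, so the two
    concavity inequalities add up to the claim. *)
Lemma clamped_variance_incr (a b h : R) : 0 <= a -> a <= b -> 0 <= h -> b + h <= L ->
  V (b + h) - V b <= V (a + h) - V a.
Proof.
move=> a0 ab h0 bhL.
rewrite !clamped_varianceE; try lra.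
have [ba|ba] := eqVneq (b + h) a.
  have h00 : h = 0 by lra.
  have bb : b = a by lra.
  by rewrite h00 bb.
have p : 0 < b + h - a by rewrite lt_neqAle eq_sym subr_eq0 ba/=; lra.
pose t := h / (b + h - a).
have t01 : 0 <= t <= 1 by rewrite divr_ge0 ?(ltW p)//= ler_pdivrMr// mul1r; lra.
have t01' : 0 <= 1 - t <= 1 by move/andP: t01 => [? ?]; apply/andP; split; lra.
have aL : 0 <= a <= L by apply/andP; split; lra.
have bL : 0 <= b + h <= L by apply/andP; split; lra.
have h1 := variance_concave aL bL t01; have h2 := variance_concave aL bL t01'.
have e1 : t * a + (1 - t) * (b + h) = b by rewrite /t; field; rewrite gt_eqF.
have e2 : (1 - t) * a + (1 - (1 - t)) * (b + h) = a + h by rewrite /t; field; rewrite gt_eqF.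
rewrite e1 in h1; rewrite e2 in h2; lra.
Qed.

(** Joint measurability is assumed only over the index interval; the extension by 0 is measurable on
    the whole product. *)
Let F : measurableTypeR R * Omega -> R :=
  (fun p : R * Omega => X p.1 p.2) \_ (D `*` [set: Omega]).

Let measurable_F : measurable_fun [set: measurableTypeR R * Omega] F.
Proof.
by apply/(measurable_restrictT _ _).1 => //; apply: measurableX => //; exact: measurable_itv.
Qed.

Let FE (s : R) w : 0 <= s -> s <= L -> F (s, w) = X s w.
Proof.
move=> s0 sL; rewrite /F patchE mem_set//; split => //=; exact: DE.
Qed.

Let integral_EFin (g : Omega -> R) : P.-integrable [set: Omega] (EFin \o g) ->
  (\int[P]_w (g w)%:E = (\int[P]_w g w)%:E)%E.
Proof. by move=> ig; rewrite /Rintegral fineK//; exact: (integrable_fin_num _ ig). Qed.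

Section second_moment.
Variables (e : R) (e0 : 0 < e) (e2T : e + e <= T) (e_le : e <= eps0).

Let f (p : measurableTypeR R * Omega) : R :=
  box 0 T p.1 * (F (p.1 + e, p.2) - F p) ^+ m.

Let measurable_f : measurable_fun [set: measurableTypeR R * Omega] f.
Proof.
apply: measurable_funM; first exact: (measurableT_comp (measurable_box 0 T)).
apply: measurable_funX; apply: measurable_funB => //.
apply: (measurableT_comp measurable_F); apply/measurable_fun_pairP; split => /=.
  by apply: measurable_funD.
exact: measurable_snd.
Qed.

Let f_in (s : R) w : 0 <= s -> s <= T -> f (s, w) = (X (s + e) w - X s w) ^+ m.
Proof.
have e0' := e0; have eps0' := e_le; move=> s0 sT.
rewrite /f /= boxE s0 sT mul1r !FE//; rewrite /L; lra.
Qed.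

Let f_out (s : R) w : ~ `[0, T]%classic s -> f (s, w) = 0.
Proof.
by rewrite /= in_itv/= => /negP/negbTE sT; rewrite /f /= boxE sT mul0r.
Qed.

Let D_in (s : R) : 0 <= s -> s <= T -> D s /\ D (s + e).
Proof.
have e0' := e0; have eps0' := e_le; have eps1 := eps0_gt0.
by move=> s0 sT; split; apply: DE; rewrite ?/L; lra.
Qed.

Let Cm : R := normal_moment (2 * m) / normal_moment 2 ^+ m * V e ^+ m.

Let f_C (s : R) : (\int[P]_w (f (s, w) ^+ 2)%:E <= Cm%:E)%E.
Proof.
have e0' := e0; have eps0' := e_le; have T0' := T_gt0.
have Cm0 : 0 <= Cm.
  apply: mulr_ge0; last by apply: exprn_ge0; exact: clamped_variance_ge0.
  apply: divr_ge0; first exact/ltW/normal_moment_even_gt0.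
  by apply: exprn_ge0; exact/ltW/(@normal_moment_even_gt0 R 1).
have [sT|sT] := pselect (`[0, T]%classic s); last first.
  by under eq_integral do rewrite f_out// expr0n/=; rewrite integral0 lee_fin.
move: sT; rewrite /= in_itv/= => /andP[s0 sT].
have [Ds Dse] := D_in s0 sT.
have g := gaussian_increment X_gauss X_centered Ds Dse.
under eq_integral do rewrite f_in// -exprM mulnC.
have := integral_EFin (integrable_centered_gaussian_exp (2 * m) g).
move=> ->; rewrite lee_fin (centered_gaussian_even_moment m g.1 g.2).
rewrite (increment_second_moment X_incr)// addrAC subrr add0r ger0_norm ?(ltW e0)//.
by rewrite /Cm clamped_varianceE//; [exact: ltW|rewrite /L; lra].
Qed.

Let K : R := cross_moment_cst R m.
Let H (u : R) := cross_moment m (V e) (theta V e u).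

Let kernelE (s t : R) : 0 <= s -> s <= T -> 0 <= t -> t <= T ->
  (\int[P]_w (f (s, w) * f (t, w))%:E = (K * H (t - s))%:E)%E.
Proof.
have e0' := e0; have eps0' := e_le; have T0' := T_gt0; have eps1 := eps0_gt0.
move=> s0 sT t0 tT.
have [Ds Dse] := D_in s0 sT; have [Dt Dte] := D_in t0 tT.
have gs := gaussian_increment X_gauss X_centered Ds Dse.
have gt := gaussian_increment X_gauss X_centered Dt Dte.
under eq_integral do rewrite !f_in//.
have := integral_EFin (integrable_centered_gaussian_expM m m gs gt) => ->.
rewrite (increments_cross_moment X_gauss X_centered X_incr)//; last first.
  by congr `|_|; ring.
rewrite /K /H; congr ((_ * cross_moment _ _ _)%:E).
  by rewrite addrAC subrr add0r ger0_norm ?(ltW e0)// clamped_varianceE//; [exact: ltW|rewrite /L; lra].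
rewrite /theta.
have b (x : R) : - T <= x -> x <= T -> `|x| <= L by move=> x1 x2; rewrite ler_norml /L; apply/andP; split; lra.
have b1 (x : R) : - (T + e) <= x -> x <= T + e -> `|x| <= L.
  by move=> x1 x2; rewrite ler_norml /L; apply/andP; split; lra.
(* All distances are at most T + e <= L, where clamping changes nothing. *)
rewrite !clamped_varianceE ?normr_ge0//; try (apply: b1; lra).
have -> : t + e - s = t - s + e by ring.
have -> : `|s + e - t| = `|t - s - e| by rewrite distrC; congr `|_|; ring.
have -> : t + e - (s + e) = t - s by ring.
by ring.
Qed.

Let H_meas : measurable_fun [set: R] H.
Proof.
apply: (measurableT_comp (measurable_cross_moment m (V e))).
exact: measurable_theta clamped_variance_homo e.
Qed.

Let H_bound u : `|H u| <= cross_moment m (V e) (2 * V L).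
Proof.
apply: norm_cross_moment_mono; first exact: clamped_variance_ge0.
rewrite /theta ler_norml.
have := clamped_variance_le `|u + e|; have := clamped_variance_ge0 `|u + e|.
have := clamped_variance_le `|u - e|; have := clamped_variance_ge0 `|u - e|.
have := clamped_variance_le `|u|; have := clamped_variance_ge0 `|u| => *.
by apply/andP; split; lra.
Qed.

Let J (s : R) := \int[mu]_(u in `[0, T]) H (u - s).

Let kernel_integral (s : R) :
  (\int[mu]_t \int[P]_w (f (s, w) * f (t, w))%:E = (box 0 T s * (K * J s))%:E)%E.
Proof.
have [sT|sT] := pselect (`[0, T]%classic s); last first.
  rewrite (_ : box 0 T s = 0) ?mul0r; last first.
    by move: sT; rewrite /= in_itv/= boxE => /negP/negbTE ->.
  rewrite -[RHS](integral0 mu setT); apply: eq_integral => t _.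
  by under eq_integral do rewrite f_out// mul0r; rewrite integral0.
move: sT; rewrite /= in_itv/= => /andP[s0 sT].
rewrite boxE s0 sT mul1r.
have mHs : measurable_fun [set: R] (fun t => H (t - s)).
  by apply: (measurableT_comp H_meas); exact: measurable_funB.
have iH : mu.-integrable [set: R] (EFin \o (fun t => box 0 T t * H (t - s))).
  exact: (@integrable_box _ 0 T _ _ mHs (fun u _ _ => H_bound (u - s))).
have iKH : mu.-integrable [set: R] (EFin \o (fun t => K * (box 0 T t * H (t - s)))).
  by apply: eq_integrable (integrableZl measurableT K iH).
rewrite /J Rintegral_box -(RintegralZl K measurableT iH) /Rintegral fineK; last first.
  exact: (integrable_fin_num measurableT iKH).
apply: eq_integral => t _.
have [tT|tT] := pselect (`[0, T]%classic t).
  move: tT; rewrite /= in_itv/= => /andP[t0 tT].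
  by rewrite kernelE// boxE t0 tT mul1r.
rewrite (_ : box 0 T t = 0) ?mul0r ?mulr0; last first.
  by move: tT; rewrite /= in_itv/= boxE => /negP/negbTE ->.
by under eq_integral do rewrite [f (t, _)]f_out// mulr0; rewrite integral0.
Qed.

(** Twice the factor 3/2: once for each side of s. *)
Let J_le (s : R) : 0 <= s -> s <= T -> J s <= 3 * linear_cst R m * V e ^+ m * e.
Proof.
have e0' := e0; have eps0' := e_le; have T0' := T_gt0; have e2 := e2T.
move=> s0 sT; have eL : e + e <= L by rewrite /L; lra.
rewrite /J (Rintegral_theta_split m clamped_variance_homo clamped_variance_ge0 clamped_variance_le)//.
have h y := @norm_Rintegral_theta_le R V L m clamped_variance0 clamped_variance_homo
  clamped_variance_ge0 clamped_variance_le clamped_variance_incr m_odd m_gt1 e e0 eL y.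
have yL1 : T - s + e <= L by rewrite /L; lra.
have yL2 : s + e <= L by rewrite /L; lra.
have := le_trans (ler_norm _) (h _ yL1); have := le_trans (ler_norm _) (h _ yL2); lra.
Qed.

(** As 2e <= T, one of the lengths s and T - s is at least e and gives the gain; the other side
    contributes a nonnegative amount. *)
Let J_ge (s : R) : 0 <= s -> s <= T ->
  3 / 8 * cubic_cst R m * V e ^+ (m - 3) * gap V e ^+ 3 * e <= J s.
Proof.
have e0' := e0; have eps0' := e_le; have T0' := T_gt0; have e2 := e2T.
move=> s0 sT; have eL : e + e <= L by rewrite /L; lra.
rewrite /J (Rintegral_theta_split m clamped_variance_homo clamped_variance_ge0 clamped_variance_le)//.
have h0 y := @Rintegral_theta_ge0 R V L m clamped_variance_homo
  clamped_variance_ge0 clamped_variance_le clamped_variance_incr m_odd m_gt1 e e0 eL y.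
have h y := @Rintegral_theta_ge R V L m clamped_variance_homo
  clamped_variance_ge0 clamped_variance_le clamped_variance_incr m_odd m_gt1 e e0 eL y.
have yL1 : T - s + e <= L by rewrite /L; lra.
have yL2 : s + e <= L by rewrite /L; lra.
have [es|es] := leP e s.
  have := h _ es yL2; have := h0 _ yL1; lra.
have es' : e <= T - s by lra.
have := h _ es' yL1; have := h0 _ yL2; lra.
Qed.

Let W (w : Omega) : R := \int[mu]_s f (s, w).

Let odd_variationE : odd_variation X m T e = fun w => e^-1 * W w.
Proof.
apply/funext => w; rewrite /odd_variation; congr (_ * _).
rewrite Rintegral_mkcond; apply: eq_Rintegral => s _; rewrite patchE.
have [sT|sT] := boolP (s \in `[0, T]%classic).
  by move/set_mem: sT; rewrite /= in_itv/= => /andP[s0 sT]; rewrite f_in.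
by rewrite f_out// => /mem_set; exact/negP.
Qed.

(** Every line contributes a factor e and the normalisation e^-2, which leaves 1/e; the outer
    integral gives T. *)
Lemma odd_variation_second_moment :
  [/\ measurable_fun [set: Omega] (odd_variation X m T e),
      (\int[P]_w (odd_variation X m T e w ^+ 2)%:E <=
        (3 * K * T * linear_cst R m * V e ^+ m / e)%:E)%E &
      ((3 / 8 * K * T * cubic_cst R m * V e ^+ (m - 3) * gap V e ^+ 3 / e)%:E <=
        \int[P]_w (odd_variation X m T e w ^+ 2)%:E)%E].
Proof.
have T0' := T_gt0; have K0 : 0 < K by exact: cross_moment_cst_gt0.
have eL : 0 <= gap V e.
  rewrite mulr_ge0// subr_ge0; apply: clamped_variance_homo.
  by have e0' := e0; lra.
have mT : (mu `[0%R, T]%classic = T%:E)%E.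
  by rewrite lebesgue_measure_itv/= lte_fin T0' sube0.
have mTfin : (mu `[0%R, T]%classic < +oo)%E by rewrite mT ltry.
have mTpos : (0 < mu `[0%R, T]%classic)%E by rewrite mT lte_fin.
have [mW Wfin mk E] := second_moment_Fubini (m1 := mu) (measurable_itv `[0, T]) mTfin mTpos
  measurable_f f_out f_C.
have mW' : measurable_fun [set: Omega] W by exact: mW.
have sq : (\int[P]_w (odd_variation X m T e w ^+ 2)%:E =
   (e^-1 ^+ 2)%:E * \int[mu]_s (box 0 T s * (K * J s))%:E)%E.
  rewrite odd_variationE.
  under eq_integral do rewrite exprMn EFinM.
  rewrite ge0_integralZl//=; last 3 first.
  - by apply/measurable_EFinP; exact: measurable_funX.
  - by move=> w _; rewrite lee_fin sqr_ge0.
  - by rewrite lee_fin sqr_ge0.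
  congr (_ * _)%E; apply: etrans E _.
  by apply: eq_integral => s _; exact: kernel_integral.
have mkJ : measurable_fun [set: R] (fun s => (box 0 T s * (K * J s))%:E : \bar R).
  by under eq_fun do rewrite -kernel_integral; exact: mk.
have boxc (c : R) : (\int[mu]_s (box 0 T s * c)%:E = (T * c)%:E)%E.
  have ib : mu.-integrable [set: R] (EFin \o box 0 T).
    exact: (integrable_indic_itv 0 T true false).
  have := RintegralZr c measurableT ib; rewrite Rintegral_box1 ?(ltW T0')// subr0 => <-.
  rewrite /Rintegral fineK//; apply: (integrable_fin_num measurableT).
  by apply: eq_integrable (integrableZr measurableT c ib).
have mbox (c : R) : measurable_fun [set: R] (fun s => (box 0 T s * c)%:E : \bar R).
  by apply/measurable_EFinP; apply: measurable_funM => //; exact: measurable_box.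
have k0 : 0 <= 3 / 8 * cubic_cst R m * V e ^+ (m - 3) * gap V e ^+ 3 * e.
  apply: mulr_ge0; last exact: ltW.
  apply: mulr_ge0; last exact: exprn_ge0.
  apply: mulr_ge0; last by apply: exprn_ge0; exact: clamped_variance_ge0.
  by apply: mulr_ge0 => //; exact: cubic_cst_ge0.
have J0 (s : R) : 0 <= box 0 T s * (K * J s).
  rewrite boxE; case: (leP 0 s) => s0 /=; last by rewrite mul0r.
  case: (leP s T) => sT; last by rewrite mul0r.
  by rewrite mul1r mulr_ge0 ?(ltW K0)// (le_trans k0)// J_ge.
have e00 : e != 0 by rewrite gt_eqF.
split.
- by rewrite odd_variationE; exact: measurable_funM.
- rewrite sq (_ : 3 * K * T * linear_cst R m * V e ^+ m / e =
     e^-1 ^+ 2 * (T * (K * (3 * linear_cst R m * V e ^+ m * e)))); last by field.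
  rewrite (EFinM (e^-1 ^+ 2)); apply: lee_wpmul2l; first by rewrite lee_fin sqr_ge0.
  rewrite -boxc; apply: ge0_le_integral; [exact: measurableT| |exact: mkJ|exact: mbox|].
  + by move=> s _; rewrite lee_fin.
  + move=> s _; rewrite lee_fin boxE; case: (leP 0 s) => s0 /=; last by rewrite !mul0r.
    case: (leP s T) => sT; last by rewrite !mul0r.
    by rewrite !mul1r ler_wpM2l ?(ltW K0)// J_le.
- rewrite sq (_ : 3 / 8 * K * T * cubic_cst R m * V e ^+ (m - 3) * gap V e ^+ 3 / e =
     e^-1 ^+ 2 * (T * (K * (3 / 8 * cubic_cst R m * V e ^+ (m - 3) * gap V e ^+ 3 * e)))); last by field.
  rewrite (EFinM (e^-1 ^+ 2)); apply: lee_wpmul2l; first by rewrite lee_fin sqr_ge0.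
  rewrite -boxc; apply: ge0_le_integral; [exact: measurableT| |exact: mbox|exact: mkJ|].
  + by move=> s _; rewrite lee_fin; apply: mulr_ge0; [rewrite boxE|apply: mulr_ge0 => //; exact: ltW].
  + move=> s _; rewrite lee_fin boxE; case: (leP 0 s) => s0 /=; last by rewrite !mul0r.
    case: (leP s T) => sT; last by rewrite !mul0r.
    by rewrite !mul1r ler_wpM2l ?(ltW K0)// J_ge.
Qed.

End second_moment.

(* If the variance of the increments did not vanish at 0, the mean absolute
   increments would be bounded below, which joint measurability excludes. *)
Lemma clamped_variance_right_continuous (eta : R) : 0 < eta ->
  exists h : R, 0 < h /\ V h <= eta.
Proof.
move=> eta0; apply: contrapT => nex.
have gapV (h : R) : 0 < h -> eta <= V h.
  by move=> h0; rewrite leNgt; apply/negP => lt; apply: nex; exists h; split => //; exact: ltW.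
(* Subtracting the value at time 0 does not change increments and bounds all second moments by
   [V L]. *)
pose f (p : measurableTypeR R * Omega) : R := box 0 L p.1 * (F p - F (0, p.2)).
have mf : measurable_fun [set: measurableTypeR R * Omega] f.
  apply: measurable_funM; first exact: (measurableT_comp (measurable_box 0 L)).
  apply: measurable_funB => //; apply: (measurableT_comp measurable_F).
  by apply/measurable_fun_pairP; split => /=; [exact: measurable_cst|exact: measurable_snd].
have L0 := L_gt0.
have fE (s : R) w : 0 <= s -> s <= L -> f (s, w) = X s w - X 0 w.
  by move=> s0 sL; rewrite /f /= boxE s0 sL mul1r !FE// ltW.
have fout (s : R) w : ~ `[0, L]%classic s -> f (s, w) = 0.
  by rewrite /= in_itv/= => /negP/negbTE sT; rewrite /f /= boxE sT mul0r.
have D0 : D 0 by apply: DE => //; exact: ltW.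
have fC (s : R) : (\int[P]_w (f (s, w) ^+ 2)%:E <= (V L)%:E)%E.
  have [sT|sT] := pselect (`[0, L]%classic s); last first.
    under eq_integral do rewrite fout// expr0n/=.
    by rewrite integral0 lee_fin clamped_variance_ge0.
  move: sT; rewrite /= in_itv/= => /andP[s0 sL].
  have Ds : D s by exact: DE.
  have g := gaussian_increment X_gauss X_centered D0 Ds.
  under eq_integral do rewrite fE//.
  have := integral_EFin (integrable_centered_gaussian_exp 2 g) => ->.
  rewrite (increment_second_moment X_incr)// subr0 ger0_norm// lee_fin.
  by rewrite -clamped_varianceE// clamped_variance_le.
have mL : (mu `[0%R, L]%classic < +oo)%E.
  by rewrite lebesgue_measure_itv/= lte_fin L_gt0 sube0 ltry.
have intf := integrable_bounded_second_moment (m1 := mu) (measurable_itv `[0, L]) mL mf fout fC.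
pose c4 : R := normal_moment 4 / normal_moment 2 ^+ 2.
have c40 : 0 <= c4.
  rewrite divr_ge0//; first by rewrite ltW// (normal_moment_even_gt0 2).
  by rewrite exprn_ge0// ltW// (normal_moment_even_gt0 1).
have VL0 := clamped_variance_ge0 L.
(* Truncation level: y^2 <= A y for 0 <= y <= A and y^2 <= y^4 / A^2 beyond. This choice makes the
   fourth moment term at most half the variance, so that E|Y| >= eta / (2A). *)
pose A := 2 * c4 * V L + 1.
have A1 : 1 <= A by rewrite lerDr mulr_ge0// mulr_ge0.
have A0 : 0 < A by exact: lt_le_trans A1.
apply: (@measurable_process_no_gap _ _ _ P f L (eta / (2 * A))) => //.
  by rewrite divr_gt0// mulr_gt0.
move=> s h s0 h0 shL.
have s1 : s <= L by lra.
have s2 : 0 <= s + h by lra.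
have Ds : D s by exact: DE.
have Dsh : D (s + h) by exact: DE.
pose Y w := X (s + h) w - X s w.
have g : centered_gaussian P Y := gaussian_increment X_gauss X_centered Ds Dsh.
under eq_integral do rewrite !fE// opprB addrA subrK.
have i1 : P.-integrable [set: Omega] (EFin \o Y).
  by apply: eq_integrable (integrable_centered_gaussian_exp 1 g) => // w _; rewrite expr1.
have ia : P.-integrable [set: Omega] (EFin \o (fun w => `|Y w|)) by exact: integrable_norm.
have i2 := integrable_centered_gaussian_exp 2 g.
have i4 := integrable_centered_gaussian_exp 4 g.
have -> : (\int[P]_w `|X (s + h) w - X s w|%:E = (\int[P]_w `|Y w|)%:E)%E by exact: integral_EFin.
rewrite lee_fin.
have iA : P.-integrable [set: Omega] (EFin \o (fun w => A * `|Y w|)).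
  by apply: eq_integrable (integrableZl measurableT A ia).
have iA4 : P.-integrable [set: Omega] (EFin \o (fun w => (A ^+ 2)^-1 * Y w ^+ 4)).
  by apply: eq_integrable (integrableZl measurableT (A ^+ 2)^-1 i4).
have iAA : P.-integrable [set: Omega] (EFin \o (fun w => A * `|Y w| + (A ^+ 2)^-1 * Y w ^+ 4)).
  by apply: eq_integrable (integrableD measurableT iA iA4).
have : \int[P]_w (Y w ^+ 2) <= \int[P]_w (A * `|Y w| + (A ^+ 2)^-1 * Y w ^+ 4).
  apply: le_Rintegral => // w _.
  have Yy : Y w ^+ 2 = `|Y w| ^+ 2 by rewrite real_normK ?num_real.
  have Y4 : Y w ^+ 4 = `|Y w| ^+ 4 by rewrite -[4%N]/(2 * 2)%N !exprM Yy.
  rewrite Yy Y4; have y0 := normr_ge0 (Y w); move: (`|Y w|) y0 => y y0.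
  have [yA|Ay] := leP y A.
    by rewrite expr2 (@le_trans _ _ (A * y)) ?ler_wpM2r// lerDl mulr_ge0 ?exprn_ge0// invr_ge0 exprn_ge0// ltW.
  rewrite (@le_trans _ _ ((A ^+ 2)^-1 * y ^+ 4)) ?lerDr ?mulr_ge0 ?(ltW A0)//.
  rewrite ler_pdivlMl ?exprn_gt0// -[4%N]/(2 + 2)%N exprD ler_wpM2r ?exprn_ge0//.
  by apply: lerXn2r; rewrite ?nnegrE ?(ltW A0)// ltW.
rewrite (RintegralD measurableT iA iA4) (RintegralZl _ measurableT ia) (RintegralZl _ measurableT i4).
rewrite /Y (increment_second_moment X_incr)// (increment_fourth_moment X_gauss X_centered X_incr)//.
have -> : s + h - s = h by ring.
have hL : h <= L by lra.
rewrite ger0_norm ?(ltW h0)// -/c4 -clamped_varianceE ?(ltW h0)//.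
have := gapV h h0; have := clamped_variance_le h; have := clamped_variance_ge0 h.
move: (V h) (\int[P]_w `|_|) => x E x0 xL ex.
have A2 : (A ^+ 2)^-1 * (c4 * x ^+ 2) <= x / 2.
  rewrite ler_pdivrMl ?exprn_gt0//.
  have h1 : c4 * x ^+ 2 <= c4 * V L * x by rewrite expr2 mulrA ler_wpM2r// ler_wpM2l.
  apply: (le_trans h1).
  have -> : A ^+ 2 * (x / 2) = (A ^+ 2 / 2) * x by ring.
  rewrite ler_wpM2r// ler_pdivlMr//.
  have : A <= A ^+ 2 by rewrite expr2 ler_peMl// ltW.
  rewrite {1}/A; lra.
move=> le; rewrite ler_pdivrMr ?mulr_gt0//; lra.
Qed.

End odd_variation.

(** * The equivalence *)

Section L2_norm.
Context d (Omega : measurableType d) (R : realType) (P : probability Omega R).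
Implicit Types (Y : Omega -> R) (c : R).

Lemma integral_powR2 Y :
  (\int[P]_w (`|(EFin \o Y) w| `^ 2) = \int[P]_w (Y w ^+ 2)%:E)%E.
Proof.
apply: eq_integral => w _ /=.
by rewrite powR_mulrn// real_normK ?num_real.
Qed.

Lemma Lnorm2_le Y c : 0 <= c -> (\int[P]_w (Y w ^+ 2)%:E <= (c ^+ 2)%:E)%E ->
  ('N[P]_2%:E[EFin \o Y] <= c%:E)%E.
Proof.
move=> c0 h; rewrite unlock /Lnorm integral_powR2.
have -> : (c%:E = (c ^+ 2)%:E `^ 2^-1)%E.
  by rewrite poweR_EFin -powR_mulrn// -powRrM divff// powRr1.
apply: gt0_ler_poweR => //; last by rewrite in_itv/= leey andbT lee_fin sqr_ge0.
rewrite in_itv/= leey andbT; apply: integral_ge0 => w _; by rewrite lee_fin sqr_ge0.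
Qed.

Lemma le_Lnorm2 Y c : 0 <= c -> ('N[P]_2%:E[EFin \o Y] <= c%:E)%E ->
  (\int[P]_w (Y w ^+ 2)%:E <= (c ^+ 2)%:E)%E.
Proof.
move=> c0 h; rewrite -integral_powR2 -powR_Lnorm//.
have -> : ((c ^+ 2)%:E = c%:E `^ 2)%E by rewrite poweR_EFin powR_mulrn.
by apply: gt0_ler_poweR => //; rewrite in_itv/= leey andbT ?lee_fin ?Lnorm_ge0.
Qed.

Lemma Lfun2_bounded Y c : 0 <= c -> measurable_fun [set: Omega] Y ->
  (\int[P]_w (Y w ^+ 2)%:E <= (c ^+ 2)%:E)%E -> Y \in Lfun P 2%:E.
Proof.
move=> c0 mY h; rewrite inE; apply/andP; split; rewrite inE//=.
by rewrite /finite_norm (le_lt_trans (Lnorm2_le c0 h))// ltry.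
Qed.

End L2_norm.

Lemma near_right0P (R : realType) (Q : R -> Prop) :
  (\forall e \near 0^'+, Q e) <->
  exists2 r0, 0 < r0 & forall e, 0 < e -> e < r0 -> Q e.
Proof.
split=> [[r0 /= r00 h]|[r0 r00 h]].
  exists r0 => // e e0 er; apply: h => //=.
  by rewrite sub0r normrN gtr0_norm.
by apply: filterS2 (nbhs_right_gt 0) (nbhs_right_lt r00).
Qed.

(** Since [rho (r / 3) = q * rho r], the increment bound says that V - C rho does not decrease from
    r to r/3. Along r / 3^n, V becomes arbitrarily small. *)
Lemma telescoping_bound (R : realType) (V rho : R -> R) (C r0 q : R) : 0 <= C ->
  {homo V : a b / a <= b} -> (forall r, 0 <= rho r) ->
  (forall r, 0 < r -> rho (r / 3) = q * rho r) ->
  (forall eta, 0 < eta -> exists h, 0 < h /\ V h <= eta) ->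
  (forall r, 0 < r -> r < r0 -> V r - V (r / 3) <= C * (1 - q) * rho r) ->
  forall r, 0 < r -> r < r0 -> V r <= C * rho r.
Proof.
move=> C0 Vh rho0 rhoq V0 inc r r_gt0 r_lt.
have pos n : 0 < r / 3 ^+ n by rewrite divr_gt0// exprn_gt0.
have step n : V r - C * rho r <= V (r / 3 ^+ n) - C * rho (r / 3 ^+ n).
  elim: n => [|n IH]; first by rewrite expr0 divr1.
  apply: (le_trans IH).
  have lt : r / 3 ^+ n < r0.
    by apply: le_lt_trans r_lt; rewrite ler_pdivrMr ?exprn_gt0// ler_peMr ?(ltW r_gt0)// exprn_ege1// ler1n.
  have := inc _ (pos n) lt; have := rhoq _ (pos n).
  have -> : r / 3 ^+ n / 3 = r / 3 ^+ n.+1 by rewrite exprSr invfM mulrA.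
  by move=> ->; lra.
apply/ler_addgt0Pl => eta eta0.
have [h [h0 Vle]] := V0 _ eta0.
pose n := (Num.truncn (r / h)).+1.
have hn : r / 3 ^+ n <= h.
  rewrite ler_pdivrMr ?exprn_gt0// mulrC -ler_pdivrMr//.
  apply: (le_trans (ltW (truncnS_gt _))).
  by rewrite -natrX ler_nat ltnW// ltn_expl.
have := step n; have := Vh _ _ hn; have := mulr_ge0 C0 (rho0 (r / 3 ^+ n)); lra.
Qed.

Section equivalence.
Context (R : realType) (d : measure_display)
  (Omega : measurableType d) (P : probability Omega R).
Variables (m : nat) (T eps0 : R) (X : R -> Omega -> R) (delta : R -> R).
Hypotheses (m_gt1 : (1 < m)%N) (m_odd : odd m) (T_gt0 : 0 < T) (eps0_gt0 : 0 < eps0)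
  (X_meas : jointly_measurable `[0, T + eps0] X)
  (X_gauss : gaussian_process P `[0, T + eps0] X)
  (X_centered : centered P `[0, T + eps0] X)
  (X_incr : increments_variance P `[0, T + eps0] X (fun r => delta r ^+ 2))
  (delta2_incr : {in `[0, T + eps0] &,
     {homo (fun r => delta r ^+ 2) : r1 r2 / r1 <= r2}})
  (delta2_concave : concave_function `[0, T + eps0] (fun r => delta r ^+ 2)).

Let V := clamped_variance T eps0 delta.
Let moment := @odd_variation_second_moment R d Omega P m T eps0 X delta
  m_gt1 m_odd T_gt0 eps0_gt0 X_meas X_gauss X_centered X_incr delta2_incr delta2_concave.

Let a : R := m%:R^-1.
Let m_neq0 : m != 0%N. Proof. by move: m_gt1; case: (m). Qed.
Let m2_neq0 : (2 * m != 0)%N. Proof. by rewrite muln_eq0. Qed.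

Let small (e : R) : 0 < e -> e < Num.min (T / 2) eps0 ->
  [/\ e + e <= T, e <= eps0 & V e = delta e ^+ 2].
Proof.
have T0' := T_gt0; have eps1 := eps0_gt0.
rewrite lt_min => e0 /andP[eT ee]; split; [lra|exact: ltW|].
by rewrite /V clamped_varianceE//; [exact: ltW|lra].
Qed.

Let r1 : R := Num.min (T / 2) eps0.
Let r1_gt0 : 0 < r1. Proof. by rewrite lt_min divr_gt0// T_gt0 eps0_gt0. Qed.

Let powR_root (n : nat) (e : R) : n != 0%N -> 0 <= e -> (e `^ n%:R^-1) ^+ n = e.
Proof.
move=> n0 e0; rewrite -powR_mulrn ?powR_ge0// -powRrM mulVf ?pnatr_eq0//.
by rewrite powRr1.
Qed.

Lemma zero_odd_variation_of_littleo :
  delta =o_ (0^'+) (fun r => r `^ (2 * m)%:R^-1) -> zero_odd_variation P X m T.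
Proof.
move=> /eqoP small_o.
pose A := 3 * cross_moment_cst R m * T * linear_cst R m.
have A0 : 0 <= A.
  apply: mulr_ge0; last exact: linear_cst_ge0.
  apply: mulr_ge0; last exact: ltW.
  by apply: mulr_ge0 => //; exact/ltW/cross_moment_cst_gt0.
have key (eps : R) : 0 < eps -> \forall e \near 0^'+,
    measurable_fun [set: Omega] (odd_variation X m T e) /\
    (\int[P]_w (odd_variation X m T e w ^+ 2)%:E <= (eps ^+ 2)%:E)%E.
  move=> eps_gt0.
  have s0 : 0 < eps ^+ 2 / (A + 1) by rewrite divr_gt0 ?exprn_gt0// ltr_wpDl.
  (* As eta <= 1, delta^(2m)(e) <= eta^(2m) e <= eta e, and A eta <= eps^2. The added 1 keeps the
     denominator positive. *)
  pose eta := Num.min 1 (eps ^+ 2 / (A + 1)).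
  have eta0 : 0 < eta by rewrite lt_min ltr01.
  have := small_o eta eta0 => /near_right0P[r0 r00 h].
  apply/near_right0P; exists (Num.min r0 r1); first by rewrite lt_min r00.
  move=> e e0; rewrite lt_min => /andP[er0 er1].
  have [e2 ee Ve] := small e0 er1.
  have [mO up _] := moment e0 e2 ee; split => //; apply: (le_trans up).
  rewrite lee_fin -/A -/V Ve -exprM ler_pdivrMr//.
  have hd : `|delta e| ^+ (2 * m) <= eta ^+ (2 * m) * e.
    rewrite -[X in _ <= _ * X](powR_root m2_neq0 (ltW e0)) -exprMn.
    apply: lerXn2r; rewrite ?nnegrE ?mulr_ge0 ?powR_ge0 ?(ltW eta0)//.
    by have := h _ e0 er0; rewrite [X in _ <= _ * X -> _]ger0_norm ?powR_ge0.
  have -> : delta e ^+ (2 * m) = `|delta e| ^+ (2 * m).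
    by rewrite !exprM real_normK ?num_real.
  have he : eta ^+ (2 * m) <= eta.
    case: (2 * m)%N m2_neq0 => // n _; rewrite exprS ler_piMr ?(ltW eta0)//.
    by rewrite exprn_ile1 ?(ltW eta0)// ge_min lexx.
  have he2 : A * eta <= eps ^+ 2.
    apply: (@le_trans _ _ (A * (eps ^+ 2 / (A + 1)))).
      by rewrite ler_wpM2l// ge_min lexx orbT.
    rewrite mulrA ler_pdivrMr ?ltr_wpDl// mulrC ler_wpM2l ?sqr_ge0//; lra.
  apply: (@le_trans _ _ (A * (eta * e))).
    by rewrite ler_wpM2l// (le_trans hd)// ler_wpM2r// ltW.
  by rewrite mulrA ler_wpM2r// ltW.
have subr0E e : odd_variation X m T e \- (fun=> 0) = odd_variation X m T e.
  by apply/funext => w /=; rewrite subr0.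
split.
- apply: filterS (key 1 ltr01) => e [mO le].
  exact: (Lfun2_bounded (ler01 : (0 : R) <= 1) mO le).
- exact: (Lfun_cst P 0 2).
- apply: ge0_cvge0 => [e|eps eps_gt0]; first exact: Lnorm_ge0.
  apply: filterS (key eps eps_gt0) => e [mO le].
  by rewrite subr0E; apply: Lnorm2_le => //; exact: ltW.
Qed.

Lemma littleo_of_zero_odd_variation :
  zero_odd_variation P X m T -> delta =o_ (0^'+) (fun r => r `^ (2 * m)%:R^-1).
Proof.
move=> [_ _ lim]; apply/eqoP => eta eta0.
have m3 : (3 <= m)%N by case: m m_odd m_gt1 => [|[|[|n]]].
have Vhomo : {homo V : x y / x <= y} by exact: clamped_variance_homo.
have V0 r : 0 <= V r by exact: clamped_variance_ge0.
pose B := 3 / 8 * cross_moment_cst R m * T * cubic_cst R m.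
have B0 : 0 < B.
  apply: mulr_gt0; last exact: cubic_cst_gt0.
  apply: mulr_gt0 => //.
  by apply: mulr_gt0; [lra|exact: cross_moment_cst_gt0].
pose rho (r : R) := r `^ a.
have rho0 r : 0 <= rho r by exact: powR_ge0.
pose q := rho 3^-1.
have q1 : q < 1.
  rewrite ltNge; apply/negP => q1.
  have : 1 <= q ^+ m by exact: exprn_ege1.
  rewrite /q /rho powR_root//; lra.
have rho43 : 0 < rho (4 / 3) by rewrite powR_gt0//; lra.
pose C := eta ^+ 2.
have C0 : 0 < C by rewrite exprn_gt0.
(* At scale 4s/3, [gap] is half of V s - V (s/3); [zeta] is chosen so that 2 zeta rho(4s/3) = C (1 -
   q) rho(s). *)
pose zeta := C * (1 - q) / (2 * rho (4 / 3)).
have zeta0 : 0 < zeta.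
  by rewrite divr_gt0 ?mulr_gt0// subr_gt0.
(* With second moment at most eps^2, the lower bound becomes gap^m <= zeta^m e, that is gap <= zeta
   rho(e). *)
pose eps := Num.sqrt (B * zeta ^+ m).
have eps_gt0 : 0 < eps by rewrite sqrtr_gt0 mulr_gt0// exprn_gt0.
have eps2 : eps ^+ 2 = B * zeta ^+ m by rewrite sqr_sqrtr// mulr_ge0 ?exprn_ge0 ?(ltW B0)// ltW.
have subr0E e : odd_variation X m T e \- (fun=> 0) = odd_variation X m T e.
  by apply/funext => w /=; rewrite subr0.
have /near_right0P[r0 r00 small_norm] :
    \forall e \near 0^'+, ('N[P]_2%:E[EFin \o odd_variation X m T e] <= eps%:E)%E.
  have /fine_cvgP[fin /cvgr0Pnorm_le/(_ _ eps_gt0) le] := lim.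
  apply: filterS2 fin le => e; rewrite /= subr0E => fin le.
  by rewrite -(fineK fin) lee_fin (le_trans (ler_norm _)).
have gap_le e : 0 < e -> e < Num.min r0 r1 -> gap V e <= zeta * rho e.
  move=> e0; rewrite lt_min => /andP[er0 er1].
  have [e2 ee _] := small e0 er1.
  have [_ _ low] := moment e0 e2 ee.
  have := le_trans low (le_Lnorm2 (ltW eps_gt0) (small_norm _ e0 er0)).
  rewrite lee_fin -/B -/V eps2 ler_pdivrMr// => h.
  have g0 : 0 <= gap V e by rewrite mulr_ge0// subr_ge0; apply: Vhomo; lra.
  have gV : gap V e <= V e.
    have h1 : V (3 / 4 * e) <= V e by apply: Vhomo; lra.
    have := V0 (4^-1 * e); have := V0 e; rewrite /gap; lra.
  have hm : gap V e ^+ m <= (zeta * rho e) ^+ m.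
    have -> : (zeta * rho e) ^+ m = zeta ^+ m * e by rewrite exprMn powR_root// ltW.
    rewrite -(ler_pM2l B0) mulrA; apply: le_trans h.
    rewrite -{1}(subnK m3) exprD mulrA ler_wpM2r ?exprn_ge0// ler_wpM2l ?(ltW B0)//.
    by apply: lerXn2r; rewrite ?nnegrE.
  have z0 : 0 <= zeta * rho e by apply: mulr_ge0 => //; exact: ltW.
  by move: hm; rewrite ler_pXn2r ?lt0n ?nnegrE.
(* The gap bound is applied at 4s/3, which must stay below both thresholds. *)
pose r2 := 3 / 4 * Num.min r0 r1.
have r20 : 0 < r2 by apply: mulr_gt0; [lra|rewrite lt_min r00].
have Vle r : 0 < r -> r < r2 -> V r <= C * rho r.
  apply: (@telescoping_bound _ V rho C r2 q (ltW C0) Vhomo rho0).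
  - move=> s /ltW s0; have i3 : 0 <= 3^-1 :> R by rewrite invr_ge0.
    by rewrite /q /rho (powRM _ s0 i3) mulrC.
  - move=> s s0; exact: (clamped_variance_right_continuous T_gt0 eps0_gt0 X_meas X_gauss X_centered X_incr delta2_incr s0).
  - move=> s s0 sr.
    have e0 : 0 < 4 / 3 * s by rewrite mulr_gt0//; lra.
    have er : 4 / 3 * s < Num.min r0 r1 by rewrite /r2 in sr; lra.
    have := gap_le _ e0 er; rewrite /gap.
    have -> : 3 / 4 * (4 / 3 * s) = s by lra.
    have -> : 4^-1 * (4 / 3 * s) = s / 3 by lra.
    have -> : zeta * rho (4 / 3 * s) = C * (1 - q) * rho s / 2.
      have i43 : 0 <= 4 / 3 :> R by lra.
      rewrite /rho (powRM _ i43 (ltW s0)).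
      by rewrite /zeta -/(rho (4 / 3)) -/(rho s); field; rewrite gt_eqF.
    lra.
apply/near_right0P; exists (Num.min r2 r1); first by rewrite lt_min r20.
move=> e e0; rewrite lt_min => /andP[er2 er1].
have [e2 ee Ve] := small e0 er1.
rewrite -(@ler_pXn2r _ 2)// ?nnegrE ?mulr_ge0 ?(ltW eta0)//.
rewrite exprMn !real_normK ?num_real// -Ve -/C.
have -> : (e `^ (2 * m)%:R^-1) ^+ 2 = rho e.
  rewrite -powR_mulrn ?powR_ge0// -powRrM natrM invfM mulrAC mulVf ?mul1r//.
exact: Vle.
Qed.

End equivalence.

Unset Implicit Arguments.

Theorem theorem6 (R : realType) (d : measure_display)
    (Omega : measurableType d) (P : probability Omega R)
    (m : nat) (T eps0 : R) (X : R -> Omega -> R) (delta : R -> R)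
    (m_gt1 : (1 < m)%N) (m_odd : odd m) (T_gt0 : 0 < T) (eps0_gt0 : 0 < eps0)
    (X_meas : jointly_measurable `[0, T + eps0] X)
    (X_gauss : gaussian_process P `[0, T + eps0] X)
    (X_centered : centered P `[0, T + eps0] X)
    (X_incr : increments_variance P `[0, T + eps0] X (fun r => delta r ^+ 2))
    (delta_ge0 : {in `[0, T + eps0], forall r, 0 <= delta r})
    (delta2_incr : {in `[0, T + eps0] &,
       {homo (fun r => delta r ^+ 2) : r1 r2 / r1 <= r2}})
    (delta2_concave : concave_function `[0, T + eps0] (fun r => delta r ^+ 2)) :
  zero_odd_variation P X m T <->
  delta =o_ (0^'+) (fun r => r `^ (2 * m)%:R^-1).
Proof.
split.
  exact: (littleo_of_zero_odd_variation m_gt1 m_odd T_gt0 eps0_gt0 X_meas X_gauss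
    X_centered X_incr delta2_incr delta2_concave).
exact: (zero_odd_variation_of_littleo m_gt1 m_odd T_gt0 eps0_gt0 X_meas X_gauss
  X_centered X_incr delta2_incr delta2_concave).
Qed.
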